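(* Let $p$ be an odd prime. The series $\mathcal W(X)=\sum_{k\ge0}W_kX^k\in\mathbf F_p[[X]]$ is algebraic over $\mathbf F_p(X)$, with $$[\mathbf F_p(X,\mathcal W):\mathbf F_p(X)]\le p^2.$$ Consequently the sequence $(W_k)_{k\ge0}$ is $p$-automatic. More concretely, for each fixed $p$ the explicit finite-state digit procedure (E) described in the context evaluates $W_k$ for every $k\ge0$ from base-$p$ expansions (that is, its output equals $W_k$), and after $p$-dependent preprocessing this requires $O(\log_p(k+2))$ state transitions.
   Context: $p$ is an odd prime. The Artin--Hasse exponential is $\operatorname{AH}_p(X)=\exp\left(\sum_{i\ge0}X^{p^i}/p^i\right)=\sum_{n\ge0}u_nX^n\in\mathbf Z_p[[X]]$, $a_n\in\mathbf F_p$ is the reduction of $u_n$ modulo $p$, and $W_k=\sum_{r=0}^k(-1)^r r\,a_{rp}a_{(k-r)p}\in\mathbf F_p$. A sequence with values in a finite set is $p$-automatic if some deterministic finite automaton with output recovers its $n$th term from the base-$p$ expansion of $n$. Constants. Let $w_p=\frac{(p-1)!+1}{p}\bmod p$, $B_n$ the Bernoulli numbers with $B_1=-1/2$, and in $\mathbf F_p$ put $\lambda_1=w_p$, $\lambda_d=B_{p-d}/d$ for $2\le d\le p-1$. For $n=\sum_i d_i(n)p^i$ with $0\le d_i(n)<p$, put $s_p(n)=\sum_i d_i(n)$, $f_p(n)=\prod_i d_i(n)!\in\mathbf F_p^\times$. Set $\rho_p(0)=0$ and for $n>0$: $\rho_p(n)=\lambda_{s_p(n)}s_p(n)!/f_p(n)$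 if $1\le s_p(n)\le p-1$; $\rho_p(n)=-1/f_p(n)$ if $s_p(n)=p$; $\rho_p(n)=0$ if $s_p(n)>p$. Set $\omega_p(0)=0$, $\omega_p(s)=\lambda_s s!$ for $1\le s\le p-1$, and $\omega_p(p)=-1$. Procedure (E). For $0\le k<p-1$ the output is $\rho_p(k)$. For $k\ge p-1$ put $K=k-(p-1)=\sum_{i=0}^{L-1}\kappa_ip^i$ with $0\le\kappa_i\le p-1$ (base-$p$ expansion with $L$ digits; if $K=0$ take $L=1$, $\kappa_0=0$). Use the state set $\mathcal S_p=\{(c,\alpha,s):0\le c,\alpha\le p-1,\ 0\le s\le p\}$ and vectors $v_i\in\mathbf F_p^{\mathcal S_p}$. (1) Let $v_0$ be the vector supported at $(0,p-1,0)$ with value $1$. (2) For $i=0,\dots,L-1$: start with $v_{i+1}=0$. For each state $(c,\alpha,s)$ and each $\alpha'$ with $0\le\alpha'\le\alpha$, let $d\in\{0,\dots,p-1\}$ be the least residue of $\kappa_i-c+\alpha'$ modulo $p$, and put $c'=\frac{d+(p-1)\alpha'+c-\kappa_i}{p}$. If $s+d\le p$, add $v_i(c,\alpha,s)\binom{\alpha}{\alpha'}\frac1{d!}$ (computed in $\mathbf F_p$) to $v_{i+1}(c',\alpha',s+d)$. (3) Output $\rho_p(k)-\sum_{\alpha=0}^{p-1}\sum_{s=0}^p\omega_p(s)\,v_L(0,\alpha,s)$. A ''state transition'' is one step of a finite-state device, upon reading one base-$p$ digit, whose finite state set and transition rule depend only on $p$; e.g. one replacement $v_i\mapsto v_{i+1}$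 in (2), which is a linear map of $\mathbf F_p^{\mathcal S_p}$ depending only on the digit $\kappa_i$. *)

(* Defs.v *)
From HB Require Import structures.
From mathcomp Require Import all_boot all_algebra.
From mathcomp Require Import boolp reals exp.
From mathcomp Require Import zify.

Set Implicit Arguments.
Unset Strict Implicit.
Unset Printing Implicit Defensive.

Import GRing.Theory.
Local Open Scope ring_scope.

Record fps (R : Type) := Fps { fpscoef : nat -> R }.

Section FpsBase.
Variable T : Type.

HB.instance Definition _ := gen_eqMixin (fps T).
HB.instance Definition _ := gen_choiceMixin (fps T).

Lemma fpsP (f g : fps T) : fpscoef f =1 fpscoef g <-> f = g.
Proof. by case: f g => f [g]; split=> [/= /funext -> | ->]. Qed.

End FpsBase.

Section FpsZmod.
Variable V : zmodType.
Implicit Types f g h : fps V.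

Definition fps_zero : fps V := Fps (fun=> 0).
Definition fps_add f g := Fps (fun n => fpscoef f n + fpscoef g n).
Definition fps_opp f := Fps (fun n => - fpscoef f n).

Fact fps_addA : associative fps_add.
Proof. by move=> f g h; apply/fpsP => n /=; rewrite addrA. Qed.
Fact fps_addC : commutative fps_add.
Proof. by move=> f g; apply/fpsP => n /=; rewrite addrC. Qed.
Fact fps_add0 : left_id fps_zero fps_add.
Proof. by move=> f; apply/fpsP => n /=; rewrite add0r. Qed.
Fact fps_addN : left_inverse fps_zero fps_opp fps_add.
Proof. by move=> f; apply/fpsP => n /=; rewrite addNr. Qed.

HB.instance Definition _ :=
  GRing.isZmodule.Build (fps V) fps_addA fps_addC fps_add0 fps_addN.

End FpsZmod.

Section FpsRing.
Variable R : comNzRingType.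
Implicit Types (f g h : fps R) (q : {poly R}).

Definition fps_one : fps R := Fps (fun n => (n == 0%N)%:R).
Definition fps_mul f g :=
  Fps (fun n => \sum_(i < n.+1) fpscoef f i * fpscoef g (n - i)).

Definition fps_of_poly q : fps R := Fps (fun n => q`_n).

Definition fps_trunc n f : {poly R} := \poly_(i < n.+1) fpscoef f i.

Fact coef_fps_trunc n f i : (i <= n)%N -> (fps_trunc n f)`_i = fpscoef f i.
Proof. by rewrite coef_poly ltnS => ->. Qed.

Fact fps_mul_poly n f g q1 q2 :
  (forall i, (i <= n)%N -> q1`_i = fpscoef f i) ->
  (forall i, (i <= n)%N -> q2`_i = fpscoef g i) ->
  fpscoef (fps_mul f g) n = (q1 * q2)`_n.
Proof.
move=> fq gq; rewrite coefM /=; apply: eq_bigr => i _.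
by rewrite fq ?gq ?leq_subr // -ltnS ltn_ord.
Qed.

Fact fps_mul_trunc n f g i : (i <= n)%N ->
  (fps_trunc n f * fps_trunc n g)`_i = fpscoef (fps_mul f g) i.
Proof.
move=> le_in; rewrite (@fps_mul_poly _ _ _ (fps_trunc n f) (fps_trunc n g)) //.
  by move=> j le_ji; rewrite coef_fps_trunc // (leq_trans le_ji).
by move=> j le_ji; rewrite coef_fps_trunc // (leq_trans le_ji).
Qed.

Fact fps_mulA : associative fps_mul.
Proof.
move=> f g h; apply/fpsP => n; pose t := fps_trunc n.
rewrite (@fps_mul_poly _ _ _ (t f) (t g * t h)).
- rewrite mulrA [RHS](@fps_mul_poly _ _ _ (t f * t g) (t h)) //.
  + by move=> i le_in; rewrite fps_mul_trunc.
  + by move=> i le_in; rewrite coef_fps_trunc.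
- by move=> i le_in; rewrite coef_fps_trunc.
- by move=> i le_in; rewrite fps_mul_trunc.
Qed.

Fact fps_mulC : commutative fps_mul.
Proof.
by move=> f g; apply/fpsP => n; rewrite -!(@fps_mul_trunc n) // mulrC.
Qed.

Fact fps_mul1 : left_id fps_one fps_mul.
Proof.
move=> f; apply/fpsP => n /=; rewrite big_ord_recl /= mul1r subn0 big1 ?addr0 //.
by move=> i _; rewrite mul0r.
Qed.

Fact fps_mulDl : left_distributive fps_mul +%R.
Proof.
move=> f g h; apply/fpsP => n /=; rewrite -big_split /=.
by apply: eq_bigr => i _; rewrite mulrDl.
Qed.

Fact fps_one_neq0 : fps_one != 0.
Proof.
apply/eqP => /(congr1 (fun f => fpscoef f 0)) /= /eqP.
by rewrite oner_eq0.
Qed.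

HB.instance Definition _ := GRing.Zmodule_isComNzRing.Build (fps R)
  fps_mulA fps_mulC fps_mul1 fps_mulDl fps_one_neq0.

Fact fps_of_poly_is_zmod_morphism : zmod_morphism fps_of_poly.
Proof. by move=> q1 q2; apply/fpsP => n /=; rewrite coefB. Qed.

Fact fps_of_poly_is_monoid_morphism : monoid_morphism fps_of_poly.
Proof.
split; first by apply/fpsP => n /=; rewrite coef1.
by move=> q1 q2; apply/fpsP => n /=; rewrite coefM.
Qed.

HB.instance Definition _ := GRing.isZmodMorphism.Build _ _ fps_of_poly
  fps_of_poly_is_zmod_morphism.
HB.instance Definition _ := GRing.isMonoidMorphism.Build _ _ fps_of_poly
  fps_of_poly_is_monoid_morphism.

Lemma fps_of_poly_inj : injective fps_of_poly.
Proof.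
move=> q1 q2 /(congr1 (@fpscoef _)) eq12.
by apply/polyP => n; apply: (congr1 (fun u => u n) eq12).
Qed.

Definition fps_unit : pred (fps R) := fun f => `[< exists g, g * f = 1 >].

Definition fps_inv f : fps R :=
  if pselect (exists g, g * f = 1) is left ex then projT1 (cid ex) else f.

Fact fps_mulV : {in fps_unit, left_inverse 1 fps_inv *%R}.
Proof.
move=> f /asboolP unit_f; rewrite /fps_inv; case: pselect => // ex.
exact: projT2 (cid ex).
Qed.

Fact fps_unitPl f g : g * f = 1 -> fps_unit f.
Proof. by move=> gf1; apply/asboolP; exists g. Qed.

Fact fps_inv_out : {in [predC fps_unit], fps_inv =1 id}.
Proof.
by move=> f /asboolPn nunit_f; rewrite /fps_inv; case: pselect.
Qed.

HB.instance Definition _ := GRing.ComNzRing_hasMulInverse.Build (fps R)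
  fps_mulV fps_unitPl fps_inv_out.

End FpsRing.

Section FpsIdomain.
Variable R : idomainType.
Implicit Types f g : fps R.

Fact fps_neq0 f : f != 0 ->
  exists2 n, fpscoef f n != 0 & forall i, (i < n)%N -> fpscoef f i = 0.
Proof.
move=> nz_f.
have ex : exists n, fpscoef f n != 0.
  apply: contrapT => nex; move/eqP: nz_f; apply; apply/fpsP => n.
  by apply/eqP; apply: contrapT => /negP nz; apply: nex; exists n.
case: (ex_minnP ex) => n nz_n min_n; exists n => // i lt_in.
by apply/eqP; apply: contraTT lt_in => /min_n; rewrite -leqNgt.
Qed.

Fact fps_integral f g : f * g = 0 -> (f == 0) || (g == 0).
Proof.
move=> fg0; apply: contraT; rewrite negb_or => /andP[].
case/fps_neq0=> m nz_m lt_m /fps_neq0[n nz_n lt_n].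
have := congr1 (fun h => fpscoef h (m + n)) fg0 => /=.
have lt_mmn : (m < (m + n).+1)%N by rewrite ltnS leq_addr.
rewrite (bigD1 (Ordinal lt_mmn)) //= addKn big1 ?addr0 => [/eqP|i ne_im].
  by rewrite mulf_eq0 (negPf nz_m) (negPf nz_n).
have {}ne_im : (i : nat) != m by apply: contraNneq ne_im => eq_im; apply/eqP/val_inj.
have [lt_im | le_mi] := ltnP i m; first by rewrite lt_m ?mul0r.
rewrite lt_n ?mulr0 // ltn_subLR; last by rewrite -ltnS ltn_ord.
by rewrite ltn_add2r ltn_neqAle eq_sym ne_im.
Qed.

HB.instance Definition _ :=
  GRing.ComUnitRing_isIntegral.Build (fps R) fps_integral.

End FpsIdomain.

(* Only meaningful when the constant coefficient of f is zero: then f ^+ j has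
   order at least j, and the truncated sum is the full n-th coefficient of
   \sum_j f ^+ j / j!. *)
Definition fps_exp (F : fieldType) (f : fps F) : fps F :=
  Fps (fun n => \sum_(j < n.+1) fpscoef (f ^+ j) n / j`!%:R).

Section RatfunLaurent.
Variable F : fieldType.

Definition ratfun_laurent (x : {fraction {poly F}}) : {fraction (fps F)} :=
  tofrac (fps_of_poly (\n_(repr x))) / tofrac (fps_of_poly (\d_(repr x))).

Fact tofrac_fps_of_poly_eq0 (q : {poly F}) :
  (tofrac (fps_of_poly q) == 0) = (q == 0).
Proof.
rewrite tofrac_eq0; apply/eqP/eqP => [|->]; last exact: rmorph0.
by rewrite -(rmorph0 (@fps_of_poly F)) => /fps_of_poly_inj.
Qed.

Fact fraction_repr (x : {fraction {poly F}}) :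
  x = tofrac (\n_(repr x)) / tofrac (\d_(repr x)).
Proof.
have nz_d : tofrac (\d_(repr x)) != 0 :> {fraction {poly F}}.
  by rewrite tofrac_eq0 denom_ratioP.
apply: (mulIf nz_d); rewrite divfK //.
rewrite -[X in X * _ = _]reprK; unlock FracField.tofrac.
rewrite -[LHS]FracField.pi_mul; apply/eqP; rewrite eqmodE /=.
have nz_dx := denom_ratioP (repr x); have nz_1 := oner_neq0 {poly F}.
rewrite FracField.equivfE /FracField.mulf.
by rewrite !(numer_Ratio, denom_Ratio) ?mulf_neq0 // !mulr1 mulrC.
Qed.

Fact fractionP (x : {fraction {poly F}}) :
  exists n d : {poly F}, d != 0 /\ x = tofrac n / tofrac d.
Proof.
by exists (\n_(repr x)), (\d_(repr x)); split; [exact: denom_ratioP |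
  exact: fraction_repr].
Qed.

Lemma ratfun_laurent_frac (n d : {poly F}) : d != 0 ->
  ratfun_laurent (tofrac n / tofrac d) =
  tofrac (fps_of_poly n) / tofrac (fps_of_poly d).
Proof.
move=> nz_d; set x := _ / _; rewrite /ratfun_laurent.
have nz_dx := denom_ratioP (repr x).
apply/eqP; rewrite eqr_div ?tofrac_fps_of_poly_eq0 // -!rmorphM /=.
have : tofrac n / tofrac d = tofrac (\n_(repr x)) / tofrac (\d_(repr x))
  by rewrite -fraction_repr.
move/eqP; rewrite eqr_div ?tofrac_eq0 // -!rmorphM tofrac_eq => /eqP eq_nd.
by rewrite -eq_nd eqxx.
Qed.

Fact ratfun_laurent_is_zmod_morphism : zmod_morphism ratfun_laurent.
Proof.
move=> x y; have [n [d [nz_d ->]]] := fractionP x.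
have [m [e [nz_e ->]]] := fractionP y.
have sub_frac (K : fieldType) (a b c r : K) : b != 0 -> r != 0 ->
    a / b - c / r = (a * r - c * b) / (b * r).
  by move=> nz_b nz_r; rewrite -mulNr addf_div // mulNr.
rewrite [X in ratfun_laurent X](sub_frac {fraction {poly F}}) ?tofrac_eq0 //.
rewrite -!rmorphM -rmorphB !ratfun_laurent_frac ?mulf_neq0 //.
rewrite [RHS](sub_frac {fraction (fps F)}) ?tofrac_fps_of_poly_eq0 //.
by rewrite !(rmorphB, rmorphM).
Qed.

Fact ratfun_laurent_is_monoid_morphism : monoid_morphism ratfun_laurent.
Proof.
split=> [|x y].
  have -> : 1 = tofrac 1 / tofrac 1 :> {fraction {poly F}}.
    by rewrite rmorph1 divr1.
  by rewrite ratfun_laurent_frac ?oner_neq0 // !rmorph1 divr1.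
have [n [d [nz_d ->]]] := fractionP x.
have [m [e [nz_e ->]]] := fractionP y.
rewrite mulf_div -!rmorphM !ratfun_laurent_frac ?mulf_neq0 //.
by rewrite mulf_div !rmorphM.
Qed.

HB.instance Definition _ := GRing.isZmodMorphism.Build _ _ ratfun_laurent
  ratfun_laurent_is_zmod_morphism.
HB.instance Definition _ := GRing.isMonoidMorphism.Build _ _ ratfun_laurent
  ratfun_laurent_is_monoid_morphism.

End RatfunLaurent.

Section Extensions.
Variables (K L : fieldType) (iota : K -> L).

Definition adjoin (w z : L) : Prop :=
  forall S : {pred L}, GRing.divring_closed S ->
    (forall a, iota a \in S) -> w \in S -> z \in S.

(* E has a basis of d elements over the image of iota. *)
Definition has_degree (E : L -> Prop) (d : nat) : Prop :=
  exists e : 'I_d -> L, (forall i, E (e i)) /\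
    forall z, E z ->
      exists! c : {ffun 'I_d -> K}, z = \sum_(i < d) iota (c i) * e i.

End Extensions.

(* Least significant digit first; the expansion of 0 is the one-digit word 0.
   Since every n %/ p ^ i %% p is < p, pmap insub discards nothing. *)
Definition digits (p n : nat) : seq 'I_p :=
  pmap insub (mkseq (fun i => n %/ p ^ i %% p)%N (trunc_log p n).+1).

Lemma val_digits p n : (0 < p)%N ->
  map val (digits p n) =
  mkseq (fun i => n %/ p ^ i %% p)%N (trunc_log p n).+1.
Proof.
move=> p_gt0; rewrite /digits (pmap_filter (insubK _)); apply/all_filterP.
by apply/allP => d /mapP[i _ ->]; rewrite /= insubT ?ltn_pmod.
Qed.

Record dfao (p : nat) (A : Type) := Dfao {
  dfao_state : finType;
  dfao_init : dfao_state;
  dfao_next : dfao_state -> 'I_p -> dfao_state;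
  dfao_out : dfao_state -> A
}.

Section Dfao.
Variables (p : nat) (A : Type) (M : dfao p A).

(* Output together with the number of state transitions performed. *)
Definition dfao_run (w : seq 'I_p) : A * nat :=
  let: (q, t) := foldl (fun qt d => (dfao_next qt.1 d, qt.2.+1))
                       (dfao_init M, 0%N) w in
  (dfao_out q, t).

Definition dfao_eval (w : seq 'I_p) : A := (dfao_run w).1.

End Dfao.

(* Most significant digit first. *)
Definition word_value (p : nat) (w : seq 'I_p) : nat :=
  foldl (fun n (d : 'I_p) => n * p + d)%N 0%N w.

(* The automaton is required to be correct on every word representing n, with
   or without leading zeros. *)
Definition automatic (p : nat) (A : Type) (u : nat -> A) : Prop :=
  exists M : dfao p A,
    forall (n : nat) (w : seq 'I_p), word_value w = n -> dfao_eval M w = u n.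

Section ArtinHasse.
Variable p : nat.

Definition AH_log : fps rat :=
  Fps (fun m => \sum_(i < m.+1 | (p ^ i)%N == m) (p ^ i)%:R^-1).

Definition AH : fps rat := fps_exp AH_log.

(* On a rational whose denominator is prime to p, ratr : rat -> 'F_p is
   reduction modulo p; the coefficients of AH are p-integral. *)
Definition AH_mod (n : nat) : 'F_p := ratr (fpscoef AH n).

Definition W (k : nat) : 'F_p :=
  \sum_(r < k.+1) (-1) ^+ r * r%:R * AH_mod (r * p) * AH_mod ((k - r) * p).

Definition W_series : fps 'F_p := Fps W.

End ArtinHasse.

Fixpoint bernoulli_seq (n : nat) : seq rat :=
  if n is m.+1 then
    let s := bernoulli_seq m in
    rcons s (((m == 0%N)%:R - \sum_(j < m) 'C(m.+1, j)%:R * s`_j) / m.+1%:R)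
  else [::].

(* \sum_(j <= n) 'C(n.+1, j) B_j = [n = 0], so that B_1 = - 1/2. *)
Definition bernoulli (n : nat) : rat := (bernoulli_seq n.+1)`_n.

Section Procedure.
Variable p : nat.

Definition digit_sum (n : nat) : nat := (\sum_(d <- digits p n) d)%N.

Definition digit_fact (n : nat) : 'F_p := \prod_(d <- digits p n) (d`!)%:R.

(* For 2 <= d <= p - 1 the Bernoulli number B_(p-d) is p-integral by von
   Staudt-Clausen, as p - 1 does not divide p - d unless d = 1. *)
Definition lambda (d : nat) : 'F_p :=
  if d == 1%N then (((p.-1)`!.+1) %/ p)%:R
  else ratr (bernoulli (p - d)) / d%:R.

Definition rho (n : nat) : 'F_p :=
  let s := digit_sum n in
  if n == 0%N then 0
  else if (s <= p.-1)%N then lambda s * (s`!)%:R / digit_fact n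
  else if s == p then - 1 / digit_fact n
  else 0.

Definition omega (s : nat) : 'F_p :=
  if s == 0%N then 0
  else if (s <= p.-1)%N then lambda s * (s`!)%:R
  else - 1.

(* States (c, alpha, s). *)
Definition E_state := ('I_p * 'I_p * 'I_p.+1)%type.

Definition E_vector := {ffun E_state -> 'F_p}.

Definition E_init : E_vector :=
  [ffun x : E_state =>
    [&& x.1.1 == 0%N :> nat, x.1.2 == p.-1 :> nat & x.2 == 0%N :> nat]%:R].

(* The subtractions are exact: c < p, and E_digit was chosen so that the
   numerator of E_carry is a nonnegative multiple of p. *)
Definition E_digit (kappa c alpha' : 'I_p) : nat :=
  ((kappa + (p - c) + alpha') %% p)%N.

Definition E_carry (kappa c alpha' : 'I_p) : nat :=
  ((E_digit kappa c alpha' + p.-1 * alpha' + c - kappa) %/ p)%N.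

Lemma E_carry_def (kappa c alpha' : 'I_p) :
  E_carry kappa c alpha' = (alpha'.+1 - (kappa + (p - c) + alpha') %/ p)%N /\
  (E_carry kappa c alpha' * p + kappa =
     E_digit kappa c alpha' + p.-1 * alpha' + c)%N.
Proof.
have lt_kp := ltn_ord kappa; have lt_cp := ltn_ord c.
have p_gt0 : (0 < p)%N by apply: leq_ltn_trans lt_cp.
rewrite /E_carry /E_digit; set A := (kappa + (p - c) + alpha')%N.
set N := (A %% p + p.-1 * alpha' + c)%N.
have eq_pa : (p.-1 * alpha' + alpha' = alpha' * p)%N.
  by rewrite -mulSnr prednK // mulnC.
have eqA := divn_eq A p; have lt_r := ltn_pmod A p_gt0.
have sumN : (N + A %/ p * p = kappa + alpha'.+1 * p)%N by rewrite mulSn; lia.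
have le_ap : (alpha' <= alpha' * p)%N by rewrite leq_pmulr.
have le_q : (A %/ p <= alpha'.+1)%N.
  by rewrite -ltnS ltn_divLR // !mulSn; lia.
have defN : N = ((alpha'.+1 - A %/ p) * p + kappa)%N.
  apply/eqP; rewrite -(eqn_add2r (A %/ p * p)) sumN addnAC -mulnDl subnK //.
  by rewrite addnC.
by rewrite defN addnK mulnK.
Qed.

Lemma E_carryE (kappa c alpha' : 'I_p) :
  (E_carry kappa c alpha' * p + kappa =
     E_digit kappa c alpha' + p.-1 * alpha' + c)%N.
Proof. by case: (E_carry_def kappa c alpha'). Qed.

Lemma E_carry_lt (kappa c alpha' : 'I_p) : (E_carry kappa c alpha' < p)%N.
Proof.
have lt_cp := ltn_ord c; have lt_ap := ltn_ord alpha'.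
have p_gt0 : (0 < p)%N by apply: leq_ltn_trans lt_cp.
case: (E_carry_def kappa c alpha') => -> _.
have [eq_ap | ne_ap] := eqVneq alpha'.+1 p; last first.
  by rewrite (leq_ltn_trans (leq_subr _ _)) // ltn_neqAle ne_ap.
rewrite eq_ap ltn_subrL p_gt0 andbT divn_gt0 // -[X in (X <= _)%N]eq_ap.
by rewrite -addn1 addnC leq_add2r addn_gt0 subn_gt0 lt_cp orbT.
Qed.

Definition E_step (v : E_vector) (kappa : 'I_p) : E_vector :=
  [ffun y : E_state =>
    \sum_(x : E_state) \sum_(alpha' : 'I_p | (alpha' <= x.1.2)%N)
      let d := E_digit kappa x.1.1 alpha' in
      if [&& (x.2 + d <= p)%N,
             y.1.1 == E_carry kappa x.1.1 alpha' :> nat,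
             y.1.2 == alpha' & y.2 == (x.2 + d)%N :> nat]
      then v x * 'C(x.1.2, alpha')%:R / (d`!)%:R
      else 0].

Definition E_out (v : E_vector) : 'F_p :=
  \sum_(x : E_state | x.1.1 == 0%N :> nat) omega x.2 * v x.

Definition E_output (k : nat) : 'F_p :=
  if (k < p.-1)%N then rho k
  else rho k - E_out (foldl E_step E_init (digits p (k - p.-1))).

(* The same procedure run on two finite-state devices whose tables depend only
   on p: one evaluates rho from the digits of k, tracking the digit sum (capped
   at p + 1) and the product of the digit factorials; the other iterates E_step
   over the digits of k - (p - 1). *)
Definition rho_dfao : dfao p 'F_p :=
  @Dfao p 'F_p ('I_p.+2 * 'F_p)%type (ord0, 1)
    (fun q d => (inord (minn p.+1 (q.1 + d)), q.2 * (d`!)%:R))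
    (fun q => if q.1 == 0%N :> nat then 0
              else if (q.1 <= p.-1)%N then lambda q.1 * (q.1`!)%:R / q.2
              else if q.1 == p :> nat then - 1 / q.2
              else 0).

Definition E_dfao : dfao p 'F_p := @Dfao p 'F_p E_vector E_init E_step E_out.

Definition E_run (k : nat) : 'F_p * nat :=
  let: (x, t) := dfao_run rho_dfao (digits p k) in
  if (k < p.-1)%N then (x, t)
  else let: (y, t') := dfao_run E_dfao (digits p (k - p.-1)) in
       (x - y, (t + t')%N).

End Procedure.

(* Main.v *)
Require Import Defs.
From HB Require Import structures.
From mathcomp Require Import all_boot all_order all_algebra all_field.
From mathcomp Require Import boolp reals exp.
From mathcomp Require Import ring zify.

(** Write [theta = X d/dX] and [H = X + X ^ p + X ^ (p ^ 2) + ...], and let [h]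
    be [H] modulo [p], so that [h ^ p = h - X].

    Since [W_k] is a convolution, the series [W] is the product of [G] with
    [theta G] taken at [- X], where [G] is the section of [AH] modulo [p] that
    keeps the coefficients of index [p r].  The whole theorem follows from
      [W = (1 - h ^ (p - 1)) rho]
    (lemma [W_series_rho]), where [rho] is the series with coefficients
    [rho_p (n)].  It is obtained in three steps.

    1. The differential equation [theta AH = H AH] says that the [p] sections
    [F_d] of [AH] satisfy [(d - H) F_d = F_(d-1) - p theta F_d], with
    a wrap-around [- H F_0 = X F_(p-1) - p theta F_0].  Modulo [p] this expresses
    all the sections through [G = F_0], and [AH (X) AH (- X) = 1] then gives
    [G (X) G (- X) = 1 - h ^ (p - 1)] (lemma [section0_negX]).  The product of
    all these relations has the factor [prod_(e < p) (e - H) - X = p N] on one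
    side and [p theta] on the other; dividing by [p] before reducing gives
    [theta G = (N + h ^ (p - 1)) G] (lemma [theta_section0]).

    2. The quotient [N] has two parts.  The polynomial identity
    [x (x + 1) ... (x + p - 1) = x ^ p - x + p g (x)] contributes [g (- H)],
    where the coefficients of [g], Stirling numbers divided by [p], are modulo
    [p] the [lambda_d], up to a correction in degree [p - 1] made by
    [h ^ (p - 1)]: both satisfy the triangular system obtained from
    [g (x) - g (x - 1)] (lemma [quotient_lambda]).  The other part is
    [- J], where [J = (H ^ p - H (X ^ p)) / p].

    3. The coefficient of [X ^ n] in [H ^ s] counts the writings of [n] as a
    sum of [s] powers of [p]; for [s < p] it is a multinomial coefficient of the
    base [p] digits, and for [s = p] a single carry appears, which [J] removes.
    This turns [g (h) + h ^ (p - 1) + J] into [rho] (lemma [rho_seriesE]).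

    Consequences.  As [J ^ p - J] is a polynomial in [X] and [h], the [p ^ 2]
    products [h ^ i J ^ j] span over [F_p (X)] a ring containing [W], and the
    characteristic polynomial of the multiplication by [W] bounds the degree
    (lemma [W_degree]).  With [h = X B], one has [B = 1 + X ^ (p - 1) B ^ p], and
    the variants [rho_s] of [rho] obey [rho_s = sum_d X ^ d / d! rho_(s+d) (X ^ p)].
    So the coefficients of the series [X ^ c rho_s B ^ alpha] at [p m + kappa] are
    combinations of coefficients at [m] of series of the same kind (lemma
    [state_series_rec]): this is exactly the transition of procedure (E), and
    its transpose is an automaton reading the most significant digit first. *)

Set Implicit Arguments.
Unset Strict Implicit.
Unset Printing Implicit Defensive.

Import Order.TTheory GRing.Theory Num.Theory.
Local Open Scope ring_scope.

Local Notation cf := fpscoef.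

(** * Power series: coefficients, substitutions, the Euler derivation *)

Section FpsCoef.
Variable R : comNzRingType.
Implicit Types f g : fps R.

Definition fpsX : fps R := fps_of_poly 'X.

Lemma cf1 n : cf (1 : fps R) n = (n == 0%N)%:R. Proof. by []. Qed.

Lemma cfM f g n : cf (f * g) n = \sum_(i < n.+1) cf f i * cf g (n - i).
Proof. by []. Qed.

Lemma cfN f n : cf (- f) n = - cf f n. Proof. by []. Qed.

Lemma cf_sum I (r : seq I) (P : pred I) (F : I -> fps R) n :
  cf (\sum_(i <- r | P i) F i) n = \sum_(i <- r | P i) cf (F i) n.
Proof. by apply: (big_morph (fun f => cf f n)). Qed.

Lemma cfMn f k n : cf (f *+ k) n = cf f n *+ k.
Proof. by elim: k => // k IHk; rewrite !mulrS -IHk. Qed.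

Lemma cf_natM k f n : cf (k%:R * f) n = k%:R * cf f n.
Proof. by rewrite mulr_natl cfMn mulr_natl. Qed.

Lemma cf_signM k f n : cf ((-1) ^+ k * f) n = (-1) ^+ k * cf f n.
Proof.
by elim: k => [|k IHk]; rewrite ?mul1r // !exprS !mulN1r !mulNr cfN IHk.
Qed.

Lemma cfM0 f g : cf (f * g) 0 = cf f 0 * cf g 0.
Proof. by rewrite cfM big_ord1. Qed.

Lemma cfM_cut f g n : cf g 0 = 0 ->
  cf (f * g) n = \sum_(i < n) cf f i * cf g (n - i).
Proof. by move=> g0; rewrite cfM big_ord_recr /= subnn g0 mulr0 addr0. Qed.

Lemma cfX0 f k : cf (f ^+ k) 0 = cf f 0 ^+ k.
Proof. by elim: k => // k IHk; rewrite !exprS cfM0 IHk. Qed.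

Lemma cfXM f n : cf (fpsX * f) n = if n is m.+1 then cf f m else 0.
Proof.
case: n => [|n]; first by rewrite cfM0 /= coefX mul0r.
rewrite cfM big_ord_recl /= coefX mul0r add0r big_ord_recl /= coefX mul1r.
rewrite subSS subn0 big1 ?addr0 // => i _; rewrite /bump /= coefX.
by rewrite mul0r.
Qed.

Lemma cfXnM k f n :
  cf (fpsX ^+ k * f) n = if (n < k)%N then 0 else cf f (n - k).
Proof.
elim: k n => [|k IHk] n; first by rewrite mul1r subn0.
by rewrite exprS -mulrA cfXM; case: n => // n; rewrite IHk ltnS subSS.
Qed.

Lemma fpsX_neq0 : fpsX != 0.
Proof.
apply/eqP=> /(congr1 (fun f => cf f 1)) /=; rewrite coefX => /eqP.
by rewrite oner_eq0.
Qed.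

Lemma cf_exp_small f k n : cf f 0 = 0 -> (n < k)%N -> cf (f ^+ k) n = 0.
Proof.
move=> f0; elim: k n => // k IHk n; rewrite ltnS => le_nk.
rewrite exprS cfM big_ord_recl f0 mul0r add0r big1 // => i _.
by rewrite IHk ?mulr0 //= /bump /= add1n; have := ltn_ord i; lia.
Qed.

Lemma fps_natr_inj k f g :
  (forall x y : R, k%:R * x = k%:R * y -> x = y) ->
  k%:R * f = k%:R * g -> f = g.
Proof.
move=> injk eq_fg; apply/fpsP => n; apply: injk.
by rewrite -!cf_natM eq_fg.
Qed.

End FpsCoef.

Arguments fpsX {R}.

Section FpsMap.
Variables (R S : comNzRingType) (phi : {rmorphism R -> S}).

Definition fps_map (f : fps R) : fps S := Fps (fun n => phi (cf f n)).

Fact fps_map_is_zmod_morphism : zmod_morphism fps_map.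
Proof. by move=> f g; apply/fpsP => n /=; rewrite rmorphB. Qed.

Fact fps_map_is_monoid_morphism : monoid_morphism fps_map.
Proof.
split; first by apply/fpsP => n /=; rewrite rmorph_nat.
move=> f g; apply/fpsP => n /=; rewrite rmorph_sum /=.
by apply: eq_bigr => i _; rewrite rmorphM.
Qed.

HB.instance Definition _ :=
  GRing.isZmodMorphism.Build _ _ fps_map fps_map_is_zmod_morphism.
HB.instance Definition _ :=
  GRing.isMonoidMorphism.Build _ _ fps_map fps_map_is_monoid_morphism.

Lemma fps_map_X : fps_map fpsX = fpsX.
Proof. by apply/fpsP => n /=; rewrite !coefX rmorph_nat. Qed.

End FpsMap.

Section FpsOpp.
Variable R : comNzRingType.

(** Substitution of [- X] for [X]. *)
Definition fps_negX (f : fps R) : fps R := Fps (fun n => (-1) ^+ n * cf f n).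

Fact fps_negX_is_zmod_morphism : zmod_morphism fps_negX.
Proof. by move=> f g; apply/fpsP => n /=; rewrite mulrBr. Qed.

Fact fps_negX_is_monoid_morphism : monoid_morphism fps_negX.
Proof.
split; first by apply/fpsP => -[|n]; rewrite /= ?mul1r ?mulr0.
move=> f g; apply/fpsP => n; rewrite /= mulr_sumr; apply: eq_bigr => i _.
by rewrite mulrACA -exprD subnKC // -ltnS ltn_ord.
Qed.

HB.instance Definition _ :=
  GRing.isZmodMorphism.Build _ _ fps_negX fps_negX_is_zmod_morphism.
HB.instance Definition _ :=
  GRing.isMonoidMorphism.Build _ _ fps_negX fps_negX_is_monoid_morphism.

Lemma fps_negX_X : fps_negX fpsX = - fpsX.
Proof. by apply/fpsP => -[|[|n]];
  rewrite /= !coefX ?mul1r ?mulr0 ?oppr0 ?mulr1. Qed.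

End FpsOpp.

Lemma fps_map_negX (R S : comNzRingType) (phi : {rmorphism R -> S}) f :
  fps_map phi (fps_negX f) = fps_negX (fps_map phi f).
Proof. by apply/fpsP => n /=; rewrite rmorphM rmorph_sign. Qed.

Section FpsTheta.
Variable R : comNzRingType.
Implicit Types f g : fps R.

(** The derivation [X d/dX]. *)
Definition theta f : fps R := Fps (fun n => n%:R * cf f n).

Fact theta_is_zmod_morphism : zmod_morphism theta.
Proof. by move=> f g; apply/fpsP => n /=; rewrite mulrBr. Qed.
HB.instance Definition _ :=
  GRing.isZmodMorphism.Build _ _ theta theta_is_zmod_morphism.

Lemma cf_theta0 f : cf (theta f) 0 = 0. Proof. exact: mul0r. Qed.

Lemma thetaM f g : theta (f * g) = theta f * g + f * theta g.
Proof.
apply/fpsP => n; rewrite /= mulr_sumr -big_split /=; apply: eq_bigr => i _.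
have le_in : (i <= n)%N by rewrite -ltnS.
by rewrite -{1}(subnKC le_in) natrD; ring.
Qed.

Lemma theta_natr k : theta k%:R = 0.
Proof.
apply/fpsP => -[|n] /=; first by rewrite mul0r.
by rewrite -[k%:R]mulr1 cf_natM !mulr0.
Qed.

Lemma theta1 : theta 1 = 0. Proof. exact: theta_natr 1. Qed.

Lemma thetaX : theta fpsX = fpsX.
Proof.
by apply/fpsP => -[|[|n]]; rewrite /= ?coefX ?mul0r ?mul1r ?mulr0.
Qed.

Lemma thetaXn f k : theta (f ^+ k) = k%:R * f ^+ k.-1 * theta f.
Proof.
elim: k => [|[|k] IHk]; rewrite ?theta1 ?mul0r ?mulr1 ?mul1r //.
by rewrite exprS thetaM IHk /= [f ^+ k.+1]exprS mulrS; ring.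
Qed.

Lemma theta_negX f : theta (fps_negX f) = fps_negX (theta f).
Proof. by apply/fpsP => n /=; rewrite mulrCA. Qed.

End FpsTheta.

Lemma fps_map_theta (R S : comNzRingType) (phi : {rmorphism R -> S}) f :
  fps_map phi (theta f) = theta (fps_map phi f).
Proof. by apply/fpsP => n /=; rewrite rmorphM rmorph_nat. Qed.

(** As [a] has no constant term, the coefficient of index [n] of the equation
    reads [n f_n = sum_(0 < i <= n) a_i f_(n-i)]; in characteristic 0 this
    determines the coefficients one after the other. *)
Lemma theta_eq_uniq (F : numFieldType) (a f g : fps F) :
  cf a 0 = 0 -> theta f = a * f -> theta g = a * g -> cf f 0 = cf g 0 -> f = g.
Proof.
move=> a0 Df Dg eq0; apply/fpsP => n.
elim/ltn_ind: n => -[|n] // IHn.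
apply: (mulfI (_ : n.+1%:R != 0)); first by rewrite pnatr_eq0.
rewrite -[LHS]/(cf (theta f) n.+1) -[RHS]/(cf (theta g) n.+1) Df Dg !cfM.
apply: eq_bigr => -[[|i] lt_i] _ /=; first by rewrite a0 !mul0r.
by rewrite IHn // subSS ltnS leq_subr.
Qed.

Section FpsExp.
Variables (F : numFieldType) (f : fps F).
Hypothesis f0 : cf f 0 = 0.

Lemma cf_fps_exp0 : cf (fps_exp f) 0 = 1.
Proof. by rewrite /= big_ord1 expr0 /= divr1. Qed.

Lemma theta_fps_exp : theta (fps_exp f) = theta f * fps_exp f.
Proof.
apply/fpsP => n.
have ->: cf (theta (fps_exp f)) n = \sum_(j < n) cf (f ^+ j * theta f) n / j`!%:R.
  rewrite [LHS]/= mulr_sumr big_ord_recl.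
  have ->: n%:R * (cf (f ^+ 0%N) n / (0`!)%:R) = 0 :> F.
    by case: n => [|n]; rewrite ?mul0r ?mulr0.
  rewrite add0r; apply: eq_bigr => j _; rewrite lift0 mulrA.
  rewrite -[_ * cf _ _]/(cf (theta (f ^+ j.+1)) n) thetaXn -mulrA cf_natM.
  by rewrite factS natrM invfM mulrACA mulfV ?mul1r ?pnatr_eq0.
rewrite mulrC (cfM_cut _ _ (cf_theta0 f)).
rewrite (eq_bigr (fun j : 'I_n => \sum_(i < n)
    cf (f ^+ j) i / j`!%:R * cf (theta f) (n - i))); last first.
  move=> j _; rewrite (cfM_cut _ _ (cf_theta0 f)) mulr_suml.
  by apply: eq_bigr => i _; rewrite mulrAC.
rewrite exchange_big /=; apply: eq_bigr => i _; rewrite -mulr_suml.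
congr (_ * _).
rewrite [RHS](big_ord_widen n (fun j => cf (f ^+ j) i / j`!%:R)) //.
rewrite [RHS]big_mkcond; apply: eq_bigr => j _.
by case: ltnP => // lt_ij; rewrite cf_exp_small ?mul0r.
Qed.

End FpsExp.

(** * Sections of a series along residue classes *)

Lemma sum_ord_digits (V : nmodType) (p n : nat) (F : nat -> V) :
  \sum_(i < p * n) F i = \sum_(a < n) \sum_(d < p) F (p * a + d)%N.
Proof.
elim: n => [|n IHn]; first by rewrite muln0 !big_ord0.
by rewrite mulnSr big_split_ord big_ord_recr -IHn.
Qed.

Section Sections.
Variables (R : comNzRingType) (p : nat).
Hypothesis p_gt0 : (0 < p)%N.
Implicit Types f g : fps R.

(** Substitution of [X ^ p] for [X]. *)
Definition fps_subXp f : fps R :=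
  Fps (fun n => if (p %| n)%N then cf f (n %/ p) else 0).

Definition fps_section d f : fps R := Fps (fun n => cf f (p * n + d)).

Lemma cf_section d f n : cf (fps_section d f) n = cf f (p * n + d).
Proof. by []. Qed.

Lemma cf_subXp f n :
  cf (fps_subXp f) n = if (p %| n)%N then cf f (n %/ p) else 0.
Proof. by []. Qed.

Lemma cf_subXp0 f : cf (fps_subXp f) 0 = cf f 0.
Proof. by rewrite /= dvdn0 div0n. Qed.

Lemma cf_subXpM f g N :
  cf (fps_subXp f * g) N = \sum_(a < (N %/ p).+1) cf f a * cf g (N - p * a).
Proof.
rewrite cfM.
pose F i := if (i <= N)%N then cf (fps_subXp f) i * cf g (N - i) else 0.
have le_N : (N.+1 <= p * (N %/ p).+1)%N by rewrite mulnC ltn_ceil.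
rewrite (eq_bigr (fun i : 'I_N.+1 => F i)); last first.
  by move=> i _; rewrite /F -ltnS ltn_ord.
rewrite (big_ord_widen _ F le_N) [LHS]big_mkcond /=.
rewrite (eq_bigr (fun i : 'I__ => F i)); last by move=> i _; rewrite ltnS /F;
  case: leqP.
rewrite sum_ord_digits; apply: eq_bigr => a _.
rewrite (bigD1 (Ordinal p_gt0)) //= addn0 big1 ?addr0 => [|d nz_d].
  rewrite /F /= dvdn_mulr // mulKn // ifT //.
  by rewrite mulnC -leq_divRL // -ltnS.
rewrite /F /= dvdn_addr ?dvdn_mulr //; case: leqP => // _.
rewrite gtnNdvd ?mul0r //; rewrite lt0n; apply: contraNneq nz_d => d0.
exact/eqP/val_inj.
Qed.

Lemma fps_subXpD : {morph fps_subXp : f g / f + g}.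
Proof. by move=> f g; apply/fpsP => n /=; case: ifP; rewrite ?addr0. Qed.

Lemma fps_subXp1 : fps_subXp 1 = 1.
Proof.
apply/fpsP => n /=; case: ifP => [/dvdnP[k ->]|].
  by rewrite mulnK // muln_eq0 (gtn_eqF p_gt0) orbF.
by case: n => //; rewrite dvdn0.
Qed.

Lemma fps_subXpM : {morph fps_subXp : f g / f * g}.
Proof.
move=> f g; apply/fpsP => n; rewrite cf_subXpM /=.
case: ifP => [p_n | np_n]; last first.
  rewrite big1 // => a _; rewrite dvdn_subl ?np_n ?mulr0 ?dvdn_mulr //.
  by rewrite mulnC -leq_divRL // -ltnS.
apply: eq_bigr => a _; rewrite dvdn_sub ?dvdn_mulr //; congr (_ * cf _ _).
by rewrite divnBr ?dvdn_mulr // mulKn.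
Qed.

Lemma fps_subXpXn k : {morph fps_subXp : f / f ^+ k}.
Proof.
by move=> f; elim: k => [|k IHk]; rewrite ?fps_subXp1 // !exprS fps_subXpM IHk.
Qed.

Lemma fps_subXpX : fps_subXp fpsX = fpsX ^+ p.
Proof.
apply/fpsP => m; rewrite -[fpsX ^+ p]mulr1 cfXnM cf1 /= coefX.
case: ifP => [/dvdnP[k ->]|np_m]; last first.
  case: ltnP => // le_pm; rewrite subn_eq0; case: leqP => // le_mp.
  by move: np_m; rewrite (anti_leq (introT andP (conj le_mp le_pm))) dvdnn.
rewrite mulnK //; case: ltnP => [lt_kp | le_pk].
  by case: k lt_kp => // k; rewrite mulSn ltnNge leq_addr.
congr (nat_of_bool _)%:R; rewrite subn_eq0 eqn_leq -[(k <= 1)%N](leq_pmul2r p_gt0).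
rewrite mul1n; case: (_ <= p)%N; case: k le_pk => //; rewrite mul0n leqn0.
by rewrite (gtn_eqF p_gt0).
Qed.

Lemma theta_subXp f : theta (fps_subXp f) = p%:R * fps_subXp (theta f).
Proof.
apply/fpsP => n; rewrite cf_natM /=; case: ifP => [/dvdnP[k ->]|]; last first.
  by rewrite !mulr0.
by rewrite mulnK // mulrA -natrM mulnC.
Qed.

Lemma fps_sectionD d : {morph fps_section d : f g / f + g}.
Proof. by []. Qed.

Lemma fps_section_subXpM d f g : (d < p)%N ->
  fps_section d (fps_subXp f * g) = f * fps_section d g.
Proof.
move=> lt_dp; apply/fpsP => n; rewrite cf_section cf_subXpM cfM.
rewrite mulnC divnMDl // divn_small // addn0; apply: eq_bigr => a _;
  congr (_ * cf _ _).
by rewrite addnC -addnBA ?[(n * p)%N]mulnC -?mulnBr 1?addnC // leq_pmul2l // -ltnS.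
Qed.

Lemma fps_section0_XM f : fps_section 0 (fpsX * f) = fpsX * fps_section p.-1 f.
Proof.
apply/fpsP => n; rewrite cf_section addn0 !cfXM.
case: n => [|n]; first by rewrite muln0.
by rewrite mulnSr -{2}(prednK p_gt0) addnS.
Qed.

Lemma fps_sectionS_XM d f : fps_section d.+1 (fpsX * f) = fps_section d f.
Proof. by apply/fpsP => n; rewrite cf_section addnS cfXM. Qed.

Lemma fps_section_theta d f :
  fps_section d (theta f) = p%:R * theta (fps_section d f) + d%:R * fps_section d f.
Proof.
apply/fpsP => n; rewrite -[RHS]/(cf _ n + cf _ n) !cf_natM /=.
by rewrite natrD natrM mulrDl mulrA.
Qed.

Lemma fps_section_negX d f : odd p ->
  fps_section d (fps_negX f) = (-1) ^+ d * fps_negX (fps_section d f).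
Proof.
move=> p_odd; apply/fpsP => n; rewrite cf_signM /= mulrA -exprD addnC.
by congr (_ * _); rewrite -signr_odd oddD oddM p_odd -oddD signr_odd.
Qed.

(** Indices with sum [p n] have residues [0] and [0], or [d] and [p - d] with
    [0 < d < p]; in the latter case the residues produce a carry, hence [X]. *)
Lemma fps_section0M f g :
  fps_section 0 (f * g) = fps_section 0 f * fps_section 0 g +
    fpsX * \sum_(1 <= d < p) fps_section d f * fps_section (p - d) g.
Proof.
apply/fpsP => n; rewrite -[RHS]/(cf _ n + cf _ n) cfXM.
rewrite cf_section addn0 !cfM big_ord_recr /=.
rewrite (sum_ord_digits p n (fun i => cf f i * cf g (p * n - i))).
rewrite (eq_bigr (fun a : 'I_n => cf f (p * a) * cf g (p * (n - a)) +
   \sum_(1 <= d < p) cf f (p * a + d) * cf g (p * (n - a) - d))); last first.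
  move=> a _; rewrite -(big_mkord xpredT (fun d =>
    cf f (p * a + d) * cf g (p * n - (p * a + d)))) big_ltn // addn0 -mulnBr.
  by congr (_ + _); apply: eq_bigr => d _; rewrite subnDA -mulnBr.
rewrite big_split /= addrAC; congr (_ + _).
  rewrite [RHS]big_ord_recr /= !addn0 !subnn muln0; congr (_ + _).
  by apply: eq_bigr => a _; rewrite !addn0.
case: n => [|n]; first by rewrite big_ord0.
rewrite exchange_big cf_sum !big_seq; apply: eq_bigr => d.
rewrite mem_index_iota => /andP[_ lt_dp]; rewrite cfM.
apply: eq_bigr => a _; congr (_ * cf _ _).
by rewrite subSn -1?ltnS // mulnSr -addnBA // ltnW.
Qed.

End Sections.

Lemma fps_map_section (R S : comNzRingType) (phi : {rmorphism R -> S}) p d f :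
  fps_map phi (fps_section p d f) = fps_section p d (fps_map phi f).
Proof. by []. Qed.

Lemma fps_map_subXp (R S : comNzRingType) (phi : {rmorphism R -> S}) p f :
  fps_map phi (fps_subXp p f) = fps_subXp p (fps_map phi f).
Proof. by apply/fpsP => n /=; case: ifP; rewrite ?rmorph0. Qed.

(** * The Artin-Hasse differential equation *)

Section PrimePowers.
Variables (p : nat) (p_pr : prime p).

(** The series [X + X ^ p + X ^ (p ^ 2) + ...]. *)
Definition ppow_series (R : comNzRingType) : fps R :=
  Fps (fun n => (n == p ^ logn p n)%N%:R).

Lemma cf_ppow0 R : cf (ppow_series R) 0 = 0.
Proof. by rewrite /= logn0. Qed.

Lemma ppow_series_rec R :
  ppow_series R = fpsX + fps_subXp p (ppow_series R).
Proof.
have p_gt1 := prime_gt1 p_pr; have p_gt0 := prime_gt0 p_pr.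
apply/fpsP => n; rewrite /= coefX.
have [/dvdnP[k ->] | np_n] := boolP (p %| n)%N.
  rewrite mulnK // (_ : (k * p == 1)%N = false) ?add0r; last first.
    by rewrite muln_eq1 (gtn_eqF p_gt1) andbF.
  case: k => [|k]; first by rewrite mul0n logn0.
  by rewrite lognM // [logn p p]logn_prime // eqxx expnD expn1 eqn_pmul2r.
rewrite addr0; congr (nat_of_bool _)%:R; case: n np_n => [|n] np_n;
  first by rewrite logn0.
by rewrite (_ : logn p n.+1 = 0%N) //; apply/eqP;
  rewrite -leqn0 leqNgt logn_gt0 mem_primes p_pr np_n.
Qed.

Lemma ppow_series_negX R : odd p -> fps_negX (ppow_series R) = - ppow_series R.
Proof.
move=> p_odd; apply/fpsP => n /=; case: eqP => [->|_]; last by rewrite mulr0 oppr0.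
by rewrite mulr1 -signr_odd oddX p_odd orbT expr1.
Qed.

Lemma fps_map_ppow (R S : comNzRingType) (phi : {rmorphism R -> S}) :
  fps_map phi (ppow_series R) = ppow_series S.
Proof. by apply/fpsP => n /=; rewrite rmorph_nat. Qed.

Lemma theta_AH_log : theta (AH_log p) = ppow_series rat.
Proof.
have p_gt1 := prime_gt1 p_pr; have p_gt0 := prime_gt0 p_pr.
apply/fpsP => n; rewrite /=; case: eqP => [def_n | ne_n]; last first.
  rewrite big_pred0 ?mulr0 // => i; apply/eqP => def_n.
  by apply: ne_n; rewrite -def_n pfactorK.
have lt_n : (logn p n < n.+1)%N by rewrite ltnS ltnW // {2}def_n ltn_expl.
rewrite (big_pred1 (Ordinal lt_n)) /= => [|i]; last first.
  apply/eqP/eqP => [def_i|->]; last by rewrite -def_n.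
  by apply: val_inj; have /= := congr1 (logn p) def_i; rewrite pfactorK.
by rewrite -def_n mulfV // pnatr_eq0 def_n expn_eq0 negb_and -lt0n p_gt0.
Qed.

Lemma cf_AH_log0 : cf (AH_log p) 0 = 0.
Proof.
by rewrite /= big_pred0 // => i; rewrite ord1.
Qed.

Lemma cf_AH0 : cf (AH p) 0 = 1.
Proof. by rewrite cf_fps_exp0 ?cf_AH_log0. Qed.

Lemma theta_AH : theta (AH p) = ppow_series rat * AH p.
Proof. by rewrite theta_fps_exp ?cf_AH_log0 // theta_AH_log. Qed.

(** [H] is odd, so [theta] kills the product. *)
Lemma AH_negX : odd p -> AH p * fps_negX (AH p) = 1.
Proof.
move=> p_odd; apply: (@theta_eq_uniq _ 0); rewrite ?theta1 ?mul0r //.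
  rewrite thetaM theta_negX !theta_AH rmorphM /= ppow_series_negX // .
  by rewrite !mulNr mulrN mulrCA mulrA subrr.
by rewrite cfM0 [cf (fps_negX _) 0]mul1r cf_AH0 mulr1.
Qed.

(** Both sides solve [theta f = p H f], because [H = X + H (X ^ p)]. *)
Lemma AH_expp : AH p ^+ p =
  fps_subXp p (AH p) * Fps (fun n => p%:R ^+ n / n`!%:R).
Proof.
have p_gt0 := prime_gt0 p_pr; set e := Fps _.
have De : theta e = p%:R * fpsX * e.
  apply/fpsP => n; rewrite -mulrA cf_natM cfXM /=; case: n => [|n];
    first by rewrite mul0r mulr0.
  rewrite factS natrM invfM exprS mulrCA -!mulrA [n.+1%:R * _]mulrA mulfV ?mul1r //.
  by rewrite pnatr_eq0.
apply: (@theta_eq_uniq _ (p%:R * ppow_series rat)).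
- by rewrite cf_natM cf_ppow0 mulr0.
- rewrite thetaXn theta_AH.
  have -> : AH p ^+ p = AH p * AH p ^+ p.-1 by rewrite -exprS prednK.
  by ring.
- rewrite thetaM theta_subXp // theta_AH fps_subXpM // De {2}ppow_series_rec.
  by ring.
rewrite cfX0 cfM0 cf_subXp0 cf_AH0 expr1n mul1r.
by rewrite /= expr0 divr1.
Qed.
End PrimePowers.

(** * Rationals integral at a prime *)

Section LocalIntegers.
Variable p : nat.

(** The localization of the integers at [p], as a subring of the rationals. *)
Definition zloc_pred : {pred rat} := [pred x | coprimez p (denq x)].

(** The reduced denominator divides any denominator. *)
Lemma denq_dvd_frac (a b : int) : b != 0 -> (denq (a%:~R / b%:~R) %| b)%Z.
Proof.
move=> nz_b; set x := _ / _.
have eq_x : numq x * b = a * denq x.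
  apply: (intr_inj (R := rat)); rewrite !rmorphM /= numqE mulrAC.
  by rewrite divfK // intr_eq0.
have cop : coprimez (denq x) (numq x) by rewrite coprimez_sym coprimezE
  coprime_num_den.
by rewrite -(Gauss_dvdzr _ cop) eq_x dvdz_mull.
Qed.

Lemma zloc_frac (a b : int) : b != 0 -> coprimez p b -> a%:~R / b%:~R \in zloc_pred.
Proof.
move=> nz_b co_pb; rewrite inE; apply: coprimez_dvdr co_pb.
exact: denq_dvd_frac.
Qed.

Fact zloc_subring : subring_closed zloc_pred.
Proof.
have cop x y : x \in zloc_pred -> y \in zloc_pred -> coprimez p (denq x * denq y).
  by rewrite !inE coprimezMr => -> ->.
split=> [|x y Sx Sy|x y Sx Sy];
  first by rewrite inE (denq_int 1) coprimezE coprimen1.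
  rewrite -[x]divq_num_den -[y]divq_num_den -mulNr addf_div ?intr_eq0 ?denq_eq0 //.
  rewrite -rmorphN -!rmorphM -rmorphD /= -rmorphM zloc_frac ?mulf_neq0 ?denq_eq0 //.
  exact: cop.
rewrite -[x]divq_num_den -[y]divq_num_den mulf_div -!rmorphM.
by rewrite zloc_frac ?mulf_neq0 ?denq_eq0 ?cop.
Qed.
HB.instance Definition _ := GRing.isSubringClosed.Build rat zloc_pred zloc_subring.

Record zloc := Zloc { zval : rat; zvalP : zval \in zloc_pred }.
HB.instance Definition _ := [isSub for zval].
HB.instance Definition _ := [Choice of zloc by <:].
HB.instance Definition _ := [SubChoice_isSubComNzRing of zloc by <:].

Lemma zval_inj : injective zval. Proof. exact: val_inj. Qed.

Fact zval_is_zmod_morphism : zmod_morphism zval.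
Proof. exact: (rmorphB (\val : zloc -> rat)). Qed.
Fact zval_is_monoid_morphism : monoid_morphism zval.
Proof. by split; [exact: (rmorph1 (\val : zloc ->
  rat)) | exact: (rmorphM (\val : zloc -> rat))]. Qed.
HB.instance Definition _ := GRing.isZmodMorphism.Build _ _ zval
  zval_is_zmod_morphism.
HB.instance Definition _ := GRing.isMonoidMorphism.Build _ _ zval
  zval_is_monoid_morphism.

Lemma zloc_natr n : n%:R \in zloc_pred. Proof. exact: rpred_nat. Qed.

Hypothesis p_pr : prime p.

Lemma intr_Fp_eq0 (a : int) : (a%:~R == 0 :> 'F_p) = (p %| a)%Z.
Proof. by rewrite -(dvdz_pcharf (pchar_Fp p_pr)). Qed.

Lemma ratr_frac_Fp (a b : int) : ~~ (p %| b)%Z ->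
  ratr (a%:~R / b%:~R) = a%:~R / b%:~R :> 'F_p.
Proof.
move=> p'b; have nz_b : b != 0 by apply: contraNneq p'b => ->; rewrite dvdz0.
have nz_d : (denq (a%:~R / b%:~R))%:~R != 0 :> 'F_p.
  rewrite intr_Fp_eq0; apply: contra p'b => p_d.
  exact: dvdz_trans p_d (denq_dvd_frac _ nz_b).
rewrite /ratr; apply/eqP; rewrite eqr_div // ?intr_Fp_eq0 //.
rewrite -!rmorphM /=; apply/eqP; congr (_%:~R); apply: (intr_inj (R := rat)).
by rewrite !rmorphM /= numqE mulrAC divfK // intr_eq0.
Qed.

Definition zred of prime p := fun x : zloc => ratr (zval x) : 'F_p.

Lemma zloc_denqF (x : zloc) : ~~ (p %| denq (zval x))%Z.
Proof.
by have := zvalP x; rewrite inE coprimezE dvdzE /= prime_coprime.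
Qed.

Fact zred_is_zmod_morphism : zmod_morphism (zred p_pr).
Proof.
move=> x y; have dx := zloc_denqF x; have dy := zloc_denqF y.
have dxy : ~~ (p %| denq (zval x) * denq (zval y))%Z.
  by rewrite -intr_Fp_eq0 rmorphM mulf_neq0 ?intr_Fp_eq0.
rewrite /zred rmorphB /=; move: (zval x) (zval y) dx dy dxy => {}x {}y dx dy dxy.
rewrite -{1}[x]divq_num_den -{1}[y]divq_num_den -mulNr addf_div ?intr_eq0
  ?denq_eq0 //.
rewrite -rmorphN -!rmorphM -rmorphD /= -rmorphM ratr_frac_Fp //.
rewrite /ratr -[- (_ / _)]mulNr addf_div ?intr_Fp_eq0 //.
by rewrite !(rmorphM, rmorphN, rmorphD).
Qed.

Fact zred_is_monoid_morphism : monoid_morphism (zred p_pr).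
Proof.
split=> [|x y]; first by rewrite /zred rmorph1 -[1]/(1%:~R) ratr_int.
have dx := zloc_denqF x; have dy := zloc_denqF y.
have dxy : ~~ (p %| denq (zval x) * denq (zval y))%Z.
  by rewrite -intr_Fp_eq0 rmorphM mulf_neq0 ?intr_Fp_eq0.
rewrite /zred rmorphM /=; move: (zval x) (zval y) dx dy dxy => {}x {}y dx dy dxy.
rewrite -{1}[x]divq_num_den -{1}[y]divq_num_den mulf_div -!rmorphM ratr_frac_Fp //.
by rewrite /ratr mulf_div !rmorphM.
Qed.

HB.instance Definition _ :=
  GRing.isZmodMorphism.Build _ _ (zred p_pr) zred_is_zmod_morphism.
HB.instance Definition _ :=
  GRing.isMonoidMorphism.Build _ _ (zred p_pr) zred_is_monoid_morphism.

Lemma zred_eq0 x : zred p_pr x = 0 -> exists y, x = p%:R * y.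
Proof.
have nz_p : p%:R != 0 :> rat by rewrite pnatr_eq0 -lt0n prime_gt0.
move=> x0; have : zval x / p%:R \in zloc_pred; last first.
  by move=> Sy; exists (Zloc Sy); apply: zval_inj;
    rewrite rmorphM rmorph_nat /= mulrC divfK.
have : (p %| numq (zval x))%Z.
  move/eqP: x0; rewrite /zred /ratr mulf_eq0 invr_eq0 !intr_Fp_eq0.
  by rewrite (negPf (zloc_denqF x)) orbF.
case/dvdzP=> k def_k; rewrite -[zval x]divq_num_den def_k rmorphM /= mulrAC
  mulfK //.
by rewrite zloc_frac ?denq_eq0 //; have := zvalP x.
Qed.

Lemma zloc_p_inj (x y : zloc) : p%:R * x = p%:R * y -> x = y.
Proof.
have nz_p : p%:R != 0 :> rat by rewrite pnatr_eq0 -lt0n prime_gt0.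
move/(congr1 zval); rewrite !rmorphM /= rmorph_nat => /(mulfI nz_p).
exact: zval_inj.
Qed.

Lemma fps_map_zred_eq0 f : fps_map (zred p_pr) f = 0 -> exists g, f = p%:R * g.
Proof.
move=> f0; have ex n : exists y, cf f n = p%:R * y.
  by apply: zred_eq0; rewrite -[LHS]/(cf (fps_map (zred p_pr) f) n) f0.
have [g def_g] := choice ex.
by exists (Fps g); apply/fpsP => n; rewrite def_g cf_natM.
Qed.

End LocalIntegers.

(** * Integrality of the Artin-Hasse series *)

Section Integrality.

Lemma cfM_agree (R : comNzRingType) (f f' g g' : fps R) n :
    (forall i, (i < n)%N -> cf f i = cf f' i) ->
    (forall i, (i < n)%N -> cf g i = cf g' i) ->
  forall i, (i < n)%N -> cf (f * g) i = cf (f' * g') i.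
Proof.
move=> eqf eqg i lt_in; rewrite !cfM; apply: eq_bigr => j _.
have le_ji : (j <= i)%N by rewrite -ltnS.
by rewrite eqf ?eqg // (leq_ltn_trans _ lt_in) // leq_subr.
Qed.

(** The coefficient of index [n > 0] of a [k]-th power depends affinely on the
    coefficient of the same index, with slope [k] when the constant term is 1. *)
Lemma cfX_agree (R : comNzRingType) (f g : fps R) n k : (0 < n)%N ->
    cf g 0 = 1 -> (forall i, (i < n)%N -> cf f i = cf g i) ->
  cf (f ^+ k) n = cf (g ^+ k) n + k%:R * (cf f n - cf g n).
Proof.
move=> n_gt0 g0 eqfg; have f0 : cf f 0 = 1 by rewrite eqfg.
have eqX m i : (i < n)%N -> cf (f ^+ m) i = cf (g ^+ m) i.
  by elim: m i => // m IHm i lt_in; rewrite !exprS; apply: (cfM_agree eqfg IHm).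
elim: k => [|k IHk]; first by rewrite mul0r addr0.
rewrite !exprS !cfM !big_ord_recl !subn0 IHk f0 g0 !mul1r.
case: n n_gt0 eqfg eqX {IHk} => // n _ eqfg eqX.
rewrite !big_ord_recr /= /bump /= !add1n !subnn !cfX0 f0 g0 expr1n !mulr1.
rewrite (eq_bigr (fun i : 'I_n => cf g (bump 0 i) * cf (g ^+ k) (n.+1 - bump 0 i))).
  by rewrite mulrS; ring.
move=> i _; rewrite eqfg ?eqX // /bump /= ?add1n ?ltnS //; have := ltn_ord i; lia.
Qed.

Variable p : nat.
Hypotheses (p_pr : prime p) (p_odd : odd p).
Let p_gt0 : (0 < p)%N := prime_gt0 p_pr.

Lemma natr_p_Fp : p%:R = 0 :> 'F_p.
Proof. exact: pchar_Fp_0. Qed.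

Lemma Fp_expp (a : 'F_p) : a ^+ p = a.
Proof. by have := expf_card a; rewrite card_Fp. Qed.

Lemma fps_pchar_Fp : p \in [pchar (fps 'F_p)].
Proof.
rewrite inE p_pr; apply/eqP/fpsP => n.
by rewrite -[p%:R]mulr1 cf_natM natr_p_Fp mul0r.
Qed.

(** The [p]-th power is additive in characteristic [p], and it fixes the
    coefficients by Fermat's little theorem. *)
Lemma fps_Frobenius (f : fps 'F_p) : f ^+ p = fps_subXp p f.
Proof.
apply/fpsP => n; elim/ltn_ind: n f => n IHn f.
pose c := fps_of_poly (cf f 0)%:P; pose g := Fps (fun n => cf f n.+1).
have def_f : f = c + fpsX * g.
  apply/fpsP => -[|m]; rewrite -[RHS]/(cf _ _ + cf _ _) cfXM /= coefC ?addr0 //.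
  by rewrite add0r.
have cp : c ^+ p = c.
  by rewrite -!rmorphXn /= Fp_expp.
have sub_c : fps_subXp p c = c.
  apply/fpsP => -[|m] /=; rewrite !coefC ?dvdn0 ?div0n //=.
  by case: ifP => // /dvdnP[[|k] def_m] //; rewrite def_m mulnK.
rewrite {2}def_f fps_subXpD fps_subXpM // sub_c fps_subXpX //.
rewrite {1}def_f -(pFrobenius_autE fps_pchar_Fp) pFrobenius_autD_comm;
  last exact: mulrC.
rewrite !pFrobenius_autE cp exprMn -[LHS]/(cf _ _ + cf _ _) -[RHS]/(cf _ _ + cf
  _ _).
congr (_ + _); rewrite !cfXnM; case: ltnP => // le_pn.
by rewrite IHn // ltn_subrL p_gt0 (leq_trans p_gt0).
Qed.

(** Legendre's formula, with [3 floor (n / p ^ (k + 1)) <= floor (n / p ^ k)] making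
    its sum telescope to at most [n / 2]. *)
Lemma logn_fact_lt n : (0 < n)%N -> (logn p n`! < n)%N.
Proof.
have p_gt2 : (2 < p)%N := odd_prime_gt2 p_odd p_pr.
move=> n_gt0; rewrite logn_fact //.
have le_k k : (2 * (\sum_(1 <= i < k.+1) n %/ p ^ i) + n %/ p ^ k <= n)%N.
  elim: k => [|k IHk]; first by rewrite big_geq // expn0 divn1.
  rewrite big_nat_recr //= (leq_trans _ IHk) // mulnDr -addnA leq_add2l.
  rewrite -mulSnr expnSr divnMA.
  by apply: leq_trans (leq_trunc_div _ p); rewrite mulnC leq_mul.
move: (le_k n) n_gt0; move: (\sum_(_ <= _ < _) _)%N (_ %/ _)%N => S r; lia.
Qed.

(** The coefficients of [(exp (p X) - 1) / p]. *)
Lemma exp_p_fact_integral k : p%:R ^+ k / (k.+1)`!%:R \in zloc_pred p.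
Proof.
have := logn_fact_lt (ltn0Sn k); rewrite ltnS.
have [m co_pm def_f] := pfactor_coprime p_pr (fact_gt0 k.+1).
move: (logn _ _) def_f => v -> le_vk.
rewrite natrM natrX invfM mulrCA -expfB_cond ?pnatr_eq0 -?lt0n ?p_gt0 //;
  last first.
  by rewrite (gtn_eqF p_gt0) add0n.
have m_gt0 : (0 < m)%N by case: m co_pm => //;
  rewrite /coprime gcdn0 (gtn_eqF (prime_gt1 p_pr)).
rewrite mulrC -natrX !pmulrn. rewrite zloc_frac // ?coprimezE //.
by rewrite eqz_nat -lt0n.
Qed.

Lemma fps_zloc_lift (f : fps rat) : (forall n, cf f n \in zloc_pred p) ->
  exists g, f = fps_map (@zval p) g.
Proof. by move=> Zf; exists (Fps (fun n => Zloc (Zf n))); apply/fpsP. Qed.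

(** Dwork's argument.  Let [t] be the part of [AH] below degree [n], integral by
    induction.  In [AH ^ p = AH (X ^ p) exp (p X)] the coefficient of index [n]
    is that of [t ^ p] plus [p] times the unknown one on the left, and that of
    [t (X ^ p) exp (p X)] on the right.  Modulo [p] both [t ^ p] and
    [t (X ^ p) exp (p X)] reduce to [t (X ^ p)], so [p] times the unknown
    coefficient is divisible by [p]. *)
Lemma AH_integral n : cf (AH p) n \in zloc_pred p.
Proof.
elim/ltn_ind: n => n IHn; case: (posnP n) => [-> | n_gt0].
  by rewrite cf_AH0 // (zloc_natr p 1).
pose t := Fps (fun i => if (i < n)%N then cf (AH p) i else 0).
have [t' def_t] : exists t', t = fps_map (@zval p) t'.
  by apply: fps_zloc_lift => i /=; case: ifP => [/IHn // | _];
    apply: (zloc_natr p 0).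
pose e : fps rat := Fps (fun n => p%:R ^+ n / n`!%:R).
have [e' def_e] : exists e', e = 1 + p%:R * fps_map (@zval p) e'.
  exists (Fps (fun n => if n is k.+1 then Zloc (exp_p_fact_integral k) else 0)).
  apply/fpsP => i; rewrite -[RHS]/(cf _ _ + cf _ _) cf_natM /=.
  case: i => [|i]; first by rewrite rmorph0 mulr0 addr0 expr0 divr1.
  by rewrite add0r mulrA exprS.
have AH_t i : (i < n)%N -> cf (AH p) i = cf t i by move=> lt_in; rewrite /= lt_in.
pose x := cf (fps_subXp p t' * (1 + p%:R * e') - t' ^+ p) n.
have map_x : fps_map (@zval p) (fps_subXp p t' * (1 + p%:R * e') - t' ^+ p) =
    fps_subXp p t * e - t ^+ p.
  by rewrite rmorphB rmorphM rmorphXn /= fps_map_subXp !(rmorphD, rmorph1, rmorphM)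
    /= rmorph_nat -def_t -def_e.
have val_x : zval x = p%:R * cf (AH p) n.
  rewrite -[LHS]/(cf (fps_map (@zval p) _) n) map_x -[LHS]/(cf _ n - cf _ n).
  have := congr1 (fun f => cf f n) (AH_expp p_pr).
  have t0 : cf t 0 = 1 by rewrite -AH_t ?cf_AH0.
  rewrite (cfX_agree _ n_gt0 t0 AH_t) -/e.
  have ->: cf t n = 0 by rewrite /= ltnn.
  have ->: cf (fps_subXp p (AH p) * e) n = cf (fps_subXp p t * e) n.
    rewrite !cfM; apply: eq_bigr => i _; congr (_ * _).
    rewrite !cf_subXp; case: ifP => // p_i.
    rewrite AH_t //; have := ltn_ord i; rewrite ltnS => le_in.
    apply: leq_ltn_trans (_ : n %/ p < n)%N; first exact: leq_div2r.
    by rewrite ltn_Pdiv // prime_gt1.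
  by rewrite subr0 => <-; ring.
have red_x : zred p_pr x = 0.
  rewrite -[LHS]/(cf (fps_map (zred p_pr) _) n).
  suff ->: fps_map (zred p_pr) (fps_subXp p t' * (1 + p%:R * e') - t' ^+ p) = 0.
    by [].
  have p0 : p%:R = 0 :> fps 'F_p by apply/eqP; rewrite -(dvdn_pcharf fps_pchar_Fp).
  rewrite rmorphB rmorphM rmorphXn /= fps_map_subXp.
  rewrite rmorphD rmorph1 rmorphM rmorph_nat /= p0.
  by rewrite mul0r addr0 mulr1 fps_Frobenius subrr.
have [y def_x] := zred_eq0 red_x.
have nz_p : p%:R != 0 :> rat by rewrite pnatr_eq0 -lt0n.
have -> : cf (AH p) n = zval y; last exact: zvalP.
by apply: (mulfI nz_p); rewrite -val_x def_x rmorphM /= rmorph_nat.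
Qed.

Definition AHz : fps (zloc p) := Fps (fun n => Zloc (AH_integral n)).

Lemma map_AHz : fps_map (@zval p) AHz = AH p. Proof. exact/fpsP. Qed.

Lemma fps_map_zval_inj : injective (fps_map (@zval p)).
Proof. by move=> f g /fpsP eqfg; apply/fpsP => n; apply/zval_inj/eqfg. Qed.

Lemma theta_AHz : theta AHz = ppow_series p _ * AHz.
Proof.
apply: fps_map_zval_inj; rewrite fps_map_theta rmorphM /= fps_map_ppow map_AHz.
exact: theta_AH.
Qed.

Lemma AHz_negX : AHz * fps_negX AHz = 1.
Proof.
apply: fps_map_zval_inj; rewrite rmorphM /= fps_map_negX map_AHz rmorph1.
exact: AH_negX.
Qed.

End Integrality.

(** * Polynomials evaluated at series; rising factorials *)

Section FpsConst.
Variable R : comNzRingType.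

Definition fpsC (c : R) : fps R := fps_of_poly c%:P.
Fact fpsC_is_zmod_morphism : zmod_morphism fpsC.
Proof. by move=> a b; rewrite /fpsC polyCB rmorphB. Qed.
Fact fpsC_is_monoid_morphism : monoid_morphism fpsC.
Proof. by split=> [|a b]; rewrite /fpsC ?polyC1 ?rmorph1 // polyCM rmorphM. Qed.
HB.instance Definition _ := GRing.isZmodMorphism.Build _ _ fpsC
  fpsC_is_zmod_morphism.
HB.instance Definition _ := GRing.isMonoidMorphism.Build _ _ fpsC
  fpsC_is_monoid_morphism.

Lemma cf_fpsC c n : cf (fpsC c) n = if n == 0%N then c else 0.
Proof. exact: coefC. Qed.

Lemma cf_fpsCM c f n : cf (fpsC c * f) n = c * cf f n.
Proof.
rewrite cfM big_ord_recl subn0 cf_fpsC big1 ?addr0 // => i _.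
by rewrite cf_fpsC mul0r.
Qed.

Definition fps_eval (f : fps R) (q : {poly R}) : fps R := (map_poly fpsC q).[f].

Lemma fps_evalE f q : fps_eval f q = \sum_(i < size q) fpsC q`_i * f ^+ i.
Proof.
rewrite /fps_eval (@horner_coef_wide _ (size q)) ?size_poly //.
by apply: eq_bigr => i _; rewrite coef_map.
Qed.

Lemma fps_evalE_wide f (q : {poly R}) n : (size q <= n)%N ->
  fps_eval f q = \sum_(i < n) fpsC q`_i * f ^+ i.
Proof.
move=> le_qn; rewrite /fps_eval (@horner_coef_wide _ n) ?(leq_trans (size_poly
  _ _)) //.
by apply: eq_bigr => i _; rewrite coef_map.
Qed.

Lemma fps_evalD f : {morph fps_eval f : q1 q2 / q1 + q2}.
Proof. by move=> q1 q2; rewrite /fps_eval rmorphD hornerD. Qed.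
Lemma fps_evalM f : {morph fps_eval f : q1 q2 / q1 * q2}.
Proof. by move=> q1 q2; rewrite /fps_eval rmorphM hornerM. Qed.
Lemma fps_eval_prod f I (r : seq I) P (F : I -> {poly R}) :
  fps_eval f (\prod_(i <- r | P i) F i) = \prod_(i <- r | P i) fps_eval f (F i).
Proof. by rewrite /fps_eval rmorph_prod horner_prod. Qed.
Lemma fps_evalX f : fps_eval f 'X = f.
Proof. by rewrite /fps_eval map_polyX hornerX. Qed.
Lemma fps_evalN f : {morph fps_eval f : q / - q}.
Proof. by move=> q; rewrite /fps_eval rmorphN hornerN. Qed.
Lemma fps_eval_natr f n : fps_eval f n%:R = n%:R.
Proof. by rewrite /fps_eval rmorph_nat -polyC_natr hornerC. Qed.
Lemma fps_evalXn f n : fps_eval f 'X^n = f ^+ n.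
Proof. by rewrite /fps_eval map_polyXn hornerXn. Qed.
End FpsConst.

Lemma fps_map_eval (R S : comNzRingType) (phi : {rmorphism R -> S}) f q :
  fps_map phi (fps_eval f q) = fps_eval (fps_map phi f) (map_poly phi q).
Proof.
rewrite (fps_evalE_wide _ (size_poly _ _)) fps_evalE rmorph_sum.
apply: eq_bigr => i _; rewrite rmorphM rmorphXn /=; congr (_ * _).
apply/fpsP => n; rewrite cf_fpsC coef_map -[LHS]/(phi (cf (fpsC _) _)) cf_fpsC.
by case: ifP; rewrite ?rmorph0.
Qed.

Lemma fps_negX_eval (R : comNzRingType) (f : fps R) q :
  fps_negX (fps_eval f q) = fps_eval (fps_negX f) q.
Proof.
rewrite !fps_evalE rmorph_sum; apply: eq_bigr => i _; rewrite rmorphM rmorphXn /=.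
congr (_ * _); apply/fpsP => n; rewrite cf_fpsC -[LHS]/(_ * cf (fpsC _) _) cf_fpsC.
by case: eqP => [->|_]; rewrite ?mul1r ?mulr0.
Qed.

Section RisingFactorial.
Variable p : nat.
Hypothesis p_pr : prime p.

Definition rising (R : comNzRingType) (n : nat) : {poly R} :=
  \prod_(e < n) ('X + e%:R).

Lemma map_rising (R S : comNzRingType) (phi : {rmorphism R -> S}) n :
  map_poly phi (rising R n) = rising S n.
Proof.
rewrite rmorph_prod; apply: eq_bigr => i _.
by rewrite rmorphD /= map_polyX rmorph_nat.
Qed.

Lemma rising_XsubC (R : comNzRingType) n :
  rising R n = \prod_(e < n) ('X - (- e%:R)%:P).
Proof. by apply: eq_bigr => e _; rewrite polyCN opprK polyC_natr. Qed.

Lemma rising_monic (R : comNzRingType) n : rising R n \is monic.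
Proof. by rewrite rising_XsubC monic_prod_XsubC. Qed.

Lemma size_rising (R : comNzRingType) n : size (rising R n) = n.+1.
Proof. by rewrite rising_XsubC size_prod_XsubC; congr _.+1;
  rewrite /index_enum -enumT size_enum_ord. Qed.

Lemma rising_Fp : rising 'F_p p = 'X^p - 'X.
Proof.
have cast n m (F : nat -> {poly 'F_p}) : n = m ->
  \prod_(i < n) F i = \prod_(i < m) F i.
  by move->.
rewrite /rising -(cast _ _ (fun e => 'X + e%:R) (Fp_cast p_pr)).
have := finField_genPoly 'F_p; rewrite card_Fp // => ->.
rewrite [RHS](reindex_inj oppr_inj) /=; apply: eq_bigr => x _.
by rewrite polyCN opprK -polyC_natr natr_Zp.
Qed.

(** Modulo [p] the rising factorial is the product of all [x + e], [e] in the
    prime field. *)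
Lemma rising_quotient : exists2 g : {poly zloc p},
  (size g <= p)%N & rising _ p = 'X^p - 'X + p%:R * g.
Proof.
pose q : {poly zloc p} := rising _ p - ('X^p - 'X).
have q0 : map_poly (zred p_pr) q = 0.
  rewrite rmorphB /= map_rising rmorphB /= map_polyXn map_polyX rising_Fp.
  exact: subrr.
have ex n : exists y, q`_n = p%:R * y.
  by apply: zred_eq0; rewrite -[LHS]/(zred p_pr q`_n) -coef_map q0 coef0.
have [g def_g] := choice ex.
exists (\poly_(i < p) g i); first exact: size_poly.
have q_big i : (p <= i)%N -> q`_i = 0.
  move=> le_pi; rewrite /q !coefB coefXn coefX (gtn_eqF (leq_trans (prime_gt1
    p_pr) le_pi)).
  rewrite subr0; have := size_rising (zloc p) p; have := rising_monic (zloc p) p.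
  rewrite monicE lead_coefE => lead_r size_r; move: lead_r;
    rewrite size_r /= => /eqP lead_r.
  have [->|ne_ip] := eqVneq i p; first by rewrite lead_r subrr.
  by rewrite nth_default ?subr0 // size_r ltn_neqAle eq_sym ne_ip.
rewrite -[rising _ p](subrK ('X^p - 'X)) -/q addrC; congr (_ + _).
apply/polyP=> i; rewrite -polyC_natr coefCM coef_poly.
by case: ltnP => [_|/q_big->]; rewrite ?mulr0 ?def_g.
Qed.

End RisingFactorial.

(** * Logarithmic derivatives *)

Section ThetaUnits.
Variable R : comNzRingType.
Implicit Types u f : fps R.

Lemma theta_prod (I : eqType) (r : seq I) (u : I -> fps R) :
    {in r, forall i, u i \is a GRing.unit} ->
  theta (\prod_(i <- r) u i) = (\prod_(i <- r) u i) *
    \sum_(i <- r) theta (u i) / u i.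
Proof.
elim: r => [|i r IHr] Ur; first by rewrite !big_nil theta1 mulr0.
have Ui : u i \is a GRing.unit by rewrite Ur ?mem_head.
rewrite !big_cons thetaM IHr => [|j r_j]; last by rewrite Ur // in_cons r_j orbT.
rewrite mulrDr; congr (_ + _); last by rewrite mulrA.
by rewrite mulrAC [u i * _]mulrC divrK.
Qed.

Lemma thetaV u : u \is a GRing.unit -> theta u^-1 = - theta u / u ^+ 2.
Proof.
move=> Uu; apply: (mulrI Uu); have := thetaM u u^-1; rewrite divrr // theta1.
move/esym/eqP; rewrite addrC addr_eq0 => /eqP ->.
by rewrite -exprVn expr2 mulrCA [u * (_ * _)]mulrA divrr // mul1r mulNr.
Qed.
End ThetaUnits.

Lemma double_sum_ordered (R : comNzRingType) (n : nat) (x : nat -> R) :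
  (\sum_(1 <= d < n) x d * \sum_(1 <= e < d.+1) x e) *+ 2 =
  (\sum_(1 <= d < n) x d) ^+ 2 + \sum_(1 <= d < n) x d ^+ 2.
Proof.
case: n => [|n]; first by rewrite !big_geq // mul0rn expr0n addr0.
elim: n => [|n IHn]; first by rewrite !big_geq // mul0rn expr0n addr0.
by rewrite !(big_nat_recr n.+1) //= mulrnDl IHn; ring.
Qed.

(** * The sections of the Artin-Hasse series *)

Section Sections.
Variable p : nat.
Hypotheses (p_pr : prime p) (p_odd : odd p).
Let p_gt0 : (0 < p)%N := prime_gt0 p_pr.
Let p_gt1 : (1 < p)%N := prime_gt1 p_pr.
Let p_gt2 : (2 < p)%N := odd_prime_gt2 p_odd p_pr.

Local Notation red := (zred p_pr).
Local Notation H := (ppow_series p (zloc p)).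
Local Notation h := (ppow_series p 'F_p).

Let F d := fps_section p d (AHz p_pr p_odd).
Let f d := fps_map red (F d).

Lemma section_theta_rec0 : p%:R * theta (F 0) = fpsX * F p.-1 + H * F 0.
Proof.
have := congr1 (fps_section p 0) (theta_AHz p_pr p_odd).
rewrite fps_section_theta mul0r addr0 {1}ppow_series_rec // mulrDl fps_sectionD.
by rewrite fps_section0_XM // fps_section_subXpM.
Qed.

(* The operator [p theta - H + d] maps the section of index [d] to the previous
   one; [M d] is its part of order 0. *)
Let M e : fps (zloc p) := e%:R - H.
Let P d := \prod_(1 <= e < d.+1) M e.

Lemma section_theta_rec d : (d.+1 < p)%N ->
  M d.+1 * F d.+1 = F d - p%:R * theta (F d.+1).
Proof.
move=> lt_dp; have := congr1 (fps_section p d.+1) (theta_AHz p_pr p_odd).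
rewrite fps_section_theta {1}ppow_series_rec // mulrDl fps_sectionD.
rewrite fps_sectionS_XM // fps_section_subXpM // -/(F _) -/(F _) => eqF.
by rewrite mulrBl; apply/eqP; rewrite subr_eq addrAC -eqF addrAC subrr add0r.
Qed.

(** Multiplying the relations [M e F_e = F_(e-1) - p theta F_e] telescopes. *)
Lemma section_telescope d : (d < p)%N ->
  P d * F d = F 0 - p%:R * \sum_(1 <= e < d.+1) P e.-1 * theta (F e).
Proof.
elim: d => [|d IHd] lt_dp; first by rewrite /P !big_geq // mulr0 subr0 mul1r.
have ->: P d.+1 = P d * M d.+1 by rewrite /P big_nat_recr.
rewrite (big_nat_recr d.+1) //= -mulrA section_theta_rec // mulrBr IHd ?(ltnW
  lt_dp) //.
by ring.
Qed.

(** Eliminate [F_(p-1)] between the telescoped relation and the wrap-around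
    relation [X F_(p-1) = p theta F_0 - H F_0]. *)
Lemma section_closed :
  (\prod_(0 <= e < p) M e - fpsX) * F 0 =
  - (p%:R * (P p.-1 * theta (F 0) +
             fpsX * \sum_(1 <= e < p) P e.-1 * theta (F e))).
Proof.
have := section_telescope (_ : p.-1 < p)%N; rewrite prednK // => /(_ (leqnn p)).
set S := \sum_(_ <= _ < _) _ => telF.
have eqX : fpsX * F p.-1 = p%:R * theta (F 0) - H * F 0.
  by rewrite section_theta_rec0 addrK.
have P_last : P p.-1 = \prod_(1 <= e < p) M e by rewrite /P prednK.
rewrite big_ltn // -P_last {1}/M sub0r.
have : P p.-1 * (fpsX * F p.-1) = fpsX * (F 0 - p%:R * S) by rewrite mulrCA telF.
rewrite eqX => eqP1.
transitivity (P p.-1 * (p%:R * theta (F 0) - H * F 0) - fpsX * F 0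
   - p%:R * P p.-1 * theta (F 0)); first by ring.
by rewrite eqP1; ring.
Qed.

Lemma ppow_exp_Fp : h ^+ p = h - fpsX.
Proof. by rewrite fps_Frobenius // {2}ppow_series_rec // addrC addKr. Qed.

Lemma fps_Fp_p0 : p%:R = 0 :> fps 'F_p.
Proof. by apply/eqP; rewrite -(dvdn_pcharf (fps_pchar_Fp p_pr)). Qed.

Lemma theta_ppow : theta h = fpsX.
Proof.
rewrite ppow_series_rec // raddfD /= thetaX theta_subXp // fps_Fp_p0.
by rewrite mul0r addr0.
Qed.

Lemma ppow_quotient : exists J : fps (zloc p),
  H ^+ p = fps_subXp p H + p%:R * J.
Proof.
have [|J def_J] := @fps_map_zred_eq0 p p_pr (H ^+ p - fps_subXp p H).
  rewrite rmorphB rmorphXn /= fps_map_subXp fps_map_ppow.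
  by rewrite fps_Frobenius // subrr.
by exists J; rewrite -def_J addrC subrK.
Qed.

Lemma prod_sub_ppow_eval : \prod_(0 <= e < p) M e = fps_eval (- H) (rising _ p).
Proof.
rewrite big_mkord fps_eval_prod; apply: eq_bigr => e _.
by rewrite fps_evalD fps_evalX fps_eval_natr addrC.
Qed.

Section Quotients.
Variables (g : {poly zloc p}) (J : fps (zloc p)).
Hypotheses (def_g : rising _ p = 'X^p - 'X + p%:R * g)
           (def_J : H ^+ p = fps_subXp p H + p%:R * J).

Let N := fps_eval (- H) g - J.

(** Since [X = H - H (X ^ p)], the left-hand side is [p g (- H) - p J]. *)
Lemma prod_sub_ppow_quotient : \prod_(0 <= e < p) M e - fpsX = p%:R * N.
Proof.
rewrite prod_sub_ppow_eval def_g !(fps_evalD, fps_evalM, fps_evalN).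
rewrite fps_evalXn fps_evalX fps_eval_natr exprNn -signr_odd p_odd expr1 def_J.
have ->: fpsX = H - fps_subXp p H by rewrite {1}ppow_series_rec // addrK.
by rewrite /N; ring.
Qed.

(** Every term of [section_closed] is now a multiple of [p]; dividing by [p]
    before reducing keeps [theta (F 0)] visible modulo [p]. *)
Lemma section_closed_div :
  N * F 0 = - (P p.-1 * theta (F 0) +
             fpsX * \sum_(1 <= e < p) P e.-1 * theta (F e)).
Proof.
apply: (fps_natr_inj (@zloc_p_inj p p_pr)).
by rewrite mulrA -prod_sub_ppow_quotient section_closed mulrN.
Qed.

Let m e : fps 'F_p := e%:R - h.
Let pi d := \prod_(1 <= e < d.+1) m e.
Let sigma := \sum_(1 <= e < p) (m e)^-1.

Lemma map_sub_ppow e : fps_map red (M e) = m e.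
Proof. by rewrite rmorphB rmorph_nat /= fps_map_ppow. Qed.

Lemma map_prod_sub_ppow d : fps_map red (P d) = pi d.
Proof. by rewrite rmorph_prod; apply: eq_bigr => e _; rewrite -map_sub_ppow. Qed.

Lemma ppow_neq0 : h != 0.
Proof.
apply/eqP=> /(congr1 (fun f => cf f 1)) /=; rewrite logn1 expn0 eqxx => /eqP.
by rewrite oner_eq0.
Qed.

Lemma prod_sub_ppow : \prod_(0 <= e < p) m e = fpsX.
Proof.
rewrite (eq_bigr (fun e => fps_map red (M e))) => [|e _];
  last by rewrite map_sub_ppow.
apply/eqP; rewrite -subr_eq0 -rmorph_prod -(fps_map_X red) -rmorphB /=
  prod_sub_ppow_quotient.
by rewrite rmorphM rmorph_nat /= fps_Fp_p0 mul0r.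
Qed.

Lemma prod_sub_ppow_pred : pi p.-1 = h ^+ p.-1 - 1.
Proof.
have nz_h : - h != 0 by rewrite oppr_eq0 ppow_neq0.
apply: (mulfI nz_h); have := prod_sub_ppow;
  rewrite big_ltn // {1}/m sub0r /pi prednK // => ->.
have: h * h ^+ p.-1 = h - fpsX by rewrite -exprS prednK // ppow_exp_Fp.
rewrite mulrBr mulNr mulr1 opprK => ->; by rewrite opprB subrK.
Qed.

(** The series [h / X], which is the inverse of [1 - h ^ (p - 1)] because
    [h (1 - h ^ (p - 1)) = h - h ^ p = X]. *)
Definition ppow_shift : fps 'F_p := Fps (fun n => cf h n.+1).

Lemma ppow_shiftE : fpsX * ppow_shift = h.
Proof. by apply/fpsP => -[|n]; rewrite cfXM ?cf_ppow0. Qed.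

Lemma ppow_shiftK : (1 - h ^+ p.-1) * ppow_shift = 1.
Proof.
apply: (mulfI (fpsX_neq0 _)); rewrite mulr1 mulrCA ppow_shiftE mulrBl mul1r.
by rewrite -exprSr prednK // ppow_exp_Fp opprB addrC subrK.
Qed.

Lemma prod_sub_ppow_unit : pi p.-1 \is a GRing.unit.
Proof.
apply/unitrPr; exists (- ppow_shift).
by rewrite prod_sub_ppow_pred mulrN -mulNr opprB ppow_shiftK.
Qed.

Lemma sub_ppow_unit e : (0 < e < p)%N -> m e \is a GRing.unit.
Proof.
case/andP=> e_gt0 lt_ep; have := prod_sub_ppow_unit; rewrite /pi prednK //.
rewrite (@big_cat_nat _ _ _ e) //=; last exact: ltnW.
by rewrite (big_ltn lt_ep) !unitrM => /and3P[].
Qed.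

Lemma theta_sub_ppow e : theta (m e) = - fpsX.
Proof. by rewrite raddfB /= theta_natr theta_ppow sub0r. Qed.

Lemma exp_ppow_pred : h ^+ p.-1 = h * h ^+ p.-2.
Proof. by rewrite -exprS; congr (_ ^+ _); lia. Qed.

Lemma natr_pred_Fp : p.-1%:R = -1 :> fps 'F_p.
Proof.
by apply/eqP; rewrite -subr_eq0 opprK natr1 prednK // fps_Fp_p0.
Qed.

Lemma theta_exp_ppow : theta (h ^+ p.-1) = - (h ^+ p.-2 * fpsX).
Proof. by rewrite thetaXn theta_ppow natr_pred_Fp mulN1r mulNr. Qed.

(** Logarithmic derivative of [prod_(0 < e < p) (e - h) = h ^ (p - 1) - 1]. *)
Lemma fpsX_sum_inv : fpsX * sigma = - h ^+ p.-1.
Proof.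
have: theta (pi p.-1) = pi p.-1 * (- (fpsX * sigma)).
  rewrite /pi prednK // theta_prod => [|e]; last first.
    by rewrite mem_index_iota => /sub_ppow_unit.
  congr (_ * _); rewrite mulr_sumr -sumrN; apply: eq_bigr => e _.
  by rewrite theta_sub_ppow mulNr.
rewrite {1}prod_sub_ppow_pred raddfB /= theta1 subr0 theta_exp_ppow mulrN =>
  /oppr_inj.
rewrite mulrCA mulrC => /(mulfI (fpsX_neq0 _)) eq_pi.
have ->: fpsX = - (h * pi p.-1).
  by rewrite -prod_sub_ppow big_ltn // {1}/m sub0r /pi prednK // mulNr.
by rewrite mulNr -mulrA -eq_pi exp_ppow_pred.
Qed.

(** Differentiate [fpsX_sum_inv] and divide by [X]. *)
Lemma sum_inv_sqr : sigma + fpsX * \sum_(1 <= e < p) (m e)^-1 ^+ 2 = h ^+ p.-2.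
Proof.
apply: (mulfI (fpsX_neq0 _)).
have := congr1 (@theta _) fpsX_sum_inv;
  rewrite thetaM thetaX raddfN /= theta_exp_ppow opprK.
rewrite [h ^+ _ * _]mulrC => <-; rewrite mulrDr; congr (_ + _ * _).
rewrite raddf_sum mulr_sumr !big_seq; apply: eq_bigr => e;
  rewrite mem_index_iota => e_p /=.
by rewrite thetaV ?sub_ppow_unit // theta_sub_ppow opprK exprVn.
Qed.

(** Twice the double sum is the square of the sum of the inverses plus the sum of
    their squares, both known from the two previous lemmas. *)
Lemma fpsX_double_sum :
  fpsX ^+ 2 * \sum_(1 <= d < p) (m d)^-1 *
    \sum_(1 <= e < d.+1) (m e)^-1 = h ^+ p.-1.
Proof.
have nz2 : (2%:R : fps 'F_p) != 0.
  by rewrite -(dvdn_pcharf (fps_pchar_Fp p_pr)) gtnNdvd.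
apply: (mulfI nz2); rewrite mulrCA [2%:R * \sum_(_ <= _ < _) _]mulr_natl.
rewrite (double_sum_ordered _ (fun e =>
  (m e)^-1)) -/sigma mulrDr -exprMn fpsX_sum_inv sqrrN.
have := sum_inv_sqr; set s2 := \sum_(_ <= _ < _) _ => eq_s2.
have -> : fpsX ^+ 2 * s2 = fpsX * (h ^+ p.-2 - sigma) by rewrite -eq_s2; ring.
rewrite mulrBr fpsX_sum_inv opprK.
have ->: fpsX = h - h * h ^+ p.-1 by rewrite -exprS prednK // ppow_exp_Fp opprB
  addrC subrK.
by rewrite exp_ppow_pred; ring.
Qed.

Lemma section_Fp d : (d < p)%N -> pi d * f d = f 0.
Proof.
move=> lt_dp; have := congr1 (fps_map red) (section_telescope lt_dp).
by rewrite rmorphM rmorphB rmorphM rmorph_nat /= map_prod_sub_ppow fps_Fp_p0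
  mul0r subr0.
Qed.

Lemma theta_section_Fp d : (d < p)%N ->
  pi d * theta (f d) =
  theta (f 0) + fpsX * f 0 * \sum_(1 <= e < d.+1) (m e)^-1.
Proof.
elim: d => [|d IHd] lt_dp; first by rewrite /pi !big_geq // mulr0 addr0 mul1r.
have U := @sub_ppow_unit d.+1 lt_dp.
have eq_pi : pi d.+1 = pi d * m d.+1 by rewrite /pi big_nat_recr.
have def_f : f d = m d.+1 * f d.+1.
  have := congr1 (fps_map red) (section_theta_rec lt_dp).
  by rewrite rmorphM /= map_sub_ppow rmorphB rmorphM rmorph_nat /= fps_Fp_p0
    mul0r subr0.
have := IHd (ltnW lt_dp); rewrite def_f thetaM theta_sub_ppow mulrDr.
have -> : pi d * (- fpsX * f d.+1) = - (fpsX * f 0 * (m d.+1)^-1).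
  rewrite -(section_Fp lt_dp) eq_pi; move: (divrr U); move: (_^-1) => v mv1.
  by rewrite -[LHS]mulr1 -mv1; ring.
rewrite (big_nat_recr d.+1) //= mulrDr addrA mulrA -eq_pi => <-.
by ring.
Qed.

(** Insert [theta_section_Fp] into the reduction of [section_closed_div]; the
    coefficient of [theta (f 0)] collapses to [- 1] since the product
    [h ^ (p - 1) - 1] is added to [X sigma = - h ^ (p - 1)]. *)
Lemma theta_section0 :
  theta (f 0) = (fps_map red N + h ^+ p.-1) * f 0.
Proof.
move: section_closed_div; move: (N) => N1 /(congr1 (fps_map red)).
rewrite rmorphM rmorphN rmorphD 2!rmorphM /= map_prod_sub_ppow fps_map_X
  fps_map_theta -!/(f _).
rewrite rmorph_sum /=; move: (fps_map red N1) => N'.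
have -> : \sum_(1 <= e < p) fps_map red (P e.-1 * theta (F e)) =
    sigma * theta (f 0) +
    fpsX * f 0 * \sum_(1 <= d < p) (m d)^-1 * \sum_(1 <= e < d.+1) (m e)^-1.
  rewrite mulr_suml mulr_sumr -big_split !big_seq; apply: eq_bigr => d.
  rewrite mem_index_iota => d_p; have /andP[d_gt0 lt_dp] := d_p.
  rewrite rmorphM /= map_prod_sub_ppow fps_map_theta -/(f d) mulrCA -mulrDr
    -theta_section_Fp //.
  have ->: pi d = m d * pi d.-1 by rewrite /pi prednK // big_nat_recr // mulrC.
  by rewrite -mulrA mulKr ?sub_ppow_unit.
rewrite mulrDr mulrA fpsX_sum_inv prod_sub_ppow_pred => eqN;
  rewrite [RHS]mulrDl eqN.
rewrite -fpsX_double_sum; ring.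
Qed.

Lemma negX_ppow : fps_negX h = - h.
Proof. exact: ppow_series_negX. Qed.

Lemma negX_sub_ppow e : (e <= p)%N -> fps_negX (m e) = - m (p - e).
Proof.
move=> le_ep; rewrite rmorphB rmorph_nat /= negX_ppow /m natrB // fps_Fp_p0.
by ring.
Qed.

Lemma negX_prod_sub_ppow d : (d <= p)%N ->
  fps_negX (pi d) = (-1) ^+ d * \prod_(p - d <= e < p) m e.
Proof.
elim: d => [|d IHd] lt_dp; first by rewrite /pi subn0 !big_geq // mulr1 rmorph1.
rewrite /pi big_nat_recr // rmorphM /= -/(pi d) IHd 1?ltnW // negX_sub_ppow //.
have -> : \prod_(p - d.+1 <= e < p) m e = m (p - d.+1) * \prod_(p - d <= e < p) m e.
  by rewrite big_ltn; [congr (_ * \prod_(_ <= _ < _) _) | ]; lia.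
by rewrite exprS; ring.
Qed.

(** Reduce [AH (X) AH (- X) = 1] to the coefficients of index [p n].  The change
    [X -> - X] exchanges, up to sign, the factors [e - h] and [(p - e) - h], so
    the product of the section [d] at [X] with the section [p - d] at [- X] is
    [G (X) G (- X) / (d - h)], up to sign and to the product of all factors. *)
Lemma section0_negX : f 0 * fps_negX (f 0) = 1 - h ^+ p.-1.
Proof.
set G := f 0 * _.
have := congr1 (fun f => fps_section p 0 (fps_map red f)) (AHz_negX p_pr p_odd).
rewrite rmorphM rmorph1 /= fps_map_negX.
rewrite fps_section0M // -fps_map_section -/(f 0) fps_section_negX // expr0 mul1r.
rewrite -fps_map_section -/(f 0) -/G.
have -> : fps_section p 0 1 = 1 :> fps 'F_p.
  by apply/fpsP=> n; rewrite cf_section addn0 !cf1 muln_eq0 (gtn_eqF p_gt0).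
have sum_eq : pi p.-1 * (\sum_(1 <= d < p) fps_section p d (fps_map red (AHz
  p_pr p_odd)) *
      fps_section p (p - d) (fps_negX (fps_map red (AHz p_pr p_odd)))) = G * sigma.
  rewrite !mulr_sumr !big_seq; apply: eq_bigr => d.
  rewrite mem_index_iota => d_p; have /andP[d_gt0 lt_dp] := d_p.
  rewrite fps_section_negX // -!fps_map_section -!/(f _).
  apply: (mulrI (sub_ppow_unit d_p));
    rewrite mulrCA [in RHS]mulrCA divrr ?sub_ppow_unit // mulr1.
  have lt_pd : (p - d < p)%N by rewrite ltn_subrL d_gt0.
  have <- : pi d * f d * fps_negX (pi (p - d) * f (p - d)) = G.
    by rewrite !section_Fp.
  rewrite rmorphM /= negX_prod_sub_ppow ?leq_subr // subKn 1?ltnW //.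
  have ->: pi p.-1 = pi d.-1 * \prod_(d <= e < p) m e.
    by rewrite /pi !prednK // -big_cat_nat // ltnW.
  have ->: pi d = pi d.-1 * m d by rewrite /pi prednK // big_nat_recr.
  by ring.
move/(congr1 (fun y => pi p.-1 * y));
  rewrite mulr1 mulrDr [pi p.-1 * (fpsX * _)]mulrCA.
rewrite sum_eq [fpsX * _]mulrCA fpsX_sum_inv mulrC -mulrDr prod_sub_ppow_pred
  => eqG.
by apply: oppr_inj; rewrite opprB -eqG; ring.
Qed.

(** [W (X) = G (X) (theta G) (- X)], and [J] is odd while [h ^ (p - 1)] is even. *)
Lemma W_seriesE :
  W_series p = (1 - h ^+ p.-1) *
    (fps_eval h (map_poly red g) + h ^+ p.-1 + fps_map red J).
Proof.
have -> : W_series p = fps_negX (theta (f 0)) * f 0.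
  have cf_f0 n : cf (f 0) n = AH_mod p (n * p).
    by rewrite -[LHS]/(AH_mod p (p * n + 0)) addn0 mulnC.
  apply/fpsP => k; rewrite cfM; apply: eq_bigr => i _.
  rewrite -[cf (fps_negX _) i]/((-1) ^+ i * (i%:R * cf (f 0) i)).
  by rewrite !cf_f0 !mulrA.
rewrite theta_section0 rmorphM /= -mulrA [fps_negX (f 0) *
  _]mulrC section0_negX mulrC.
congr (_ * _); rewrite rmorphD rmorphXn /= negX_ppow exprNn.
have -> : (-1) ^+ p.-1 = 1 :> fps 'F_p.
  by rewrite -signr_odd -[odd _]negbK -oddS prednK // p_odd.
rewrite mul1r /N rmorphB /= fps_map_eval rmorphN /= fps_map_ppow rmorphB /=.
rewrite fps_negX_eval rmorphN /= negX_ppow opprK.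
have -> : fps_negX (fps_map red J) = - fps_map red J.
  rewrite -fps_map_negX -rmorphN; congr fps_map.
  apply: (fps_natr_inj (@zloc_p_inj p p_pr)).
  have eqJ : p%:R * J = H ^+ p - H + fpsX.
    by rewrite def_J {2}ppow_series_rec //; ring.
  have := congr1 (@fps_negX _) eqJ; rewrite rmorphM rmorph_nat /= => ->.
  rewrite mulrN eqJ !(rmorphB, rmorphD) rmorphXn /= ppow_series_negX // fps_negX_X.
  by rewrite exprNn -signr_odd p_odd expr1; ring.
by rewrite opprK addrAC.
Qed.

End Quotients.
End Sections.

(** * Base p digits *)

Section Digits.
Variable p : nat.
Hypothesis p_gt1 : (1 < p)%N.
Let p_gt0 : (0 < p)%N := ltnW p_gt1.

Lemma big_digits (T : Type) (idx : T) (op : Monoid.law idx) (phi : nat -> T) n K :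
    phi 0 = idx -> (n < p ^ K)%N ->
  \big[op/idx]_(d <- digits p n) phi d =
  \big[op/idx]_(0 <= i < K) phi (n %/ p ^ i %% p)%N.
Proof.
move=> phi0 lt_nK; rewrite -(big_map val xpredT phi) val_digits // big_map.
rewrite -[iota 0 _]/(index_iota 0 (trunc_log p n).+1).
have big0 i : (n < p ^ i)%N -> phi (n %/ p ^ i %% p)%N = idx.
  by move=> lt_n; rewrite divn_small // mod0n.
have trim a b : (a <= b)%N -> (n < p ^ a)%N ->
    \big[op/idx]_(0 <= i < b) phi (n %/ p ^ i %% p)%N =
    \big[op/idx]_(0 <= i < a) phi (n %/ p ^ i %% p)%N.
  move=> le_ab lt_na; rewrite (@big_cat_nat _ _ _ a) //=.
  rewrite [X in op _ X]big_nat_cond [X in op _ X]big1 ?Monoid.mulm1 // => i.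
  rewrite andbT => /andP[le_ai _]; apply: big0; apply: leq_trans lt_na _.
  by rewrite leq_exp2l.
have lt_nt := trunc_log_ltn n p_gt1.
by case: (leqP K (trunc_log p n).+1) => [/trim->|/ltnW/trim->].
Qed.

Lemma big_digits_cons (T : Type) (idx : T) (op : Monoid.law idx) (phi : nat ->
  T) m r :
    phi 0 = idx -> (r < p)%N ->
  \big[op/idx]_(d <- digits p (p * m + r)) phi d =
  op (phi r) (\big[op/idx]_(d <- digits p m) phi d).
Proof.
move=> phi0 lt_rp; have lt_m : (m < p ^ m)%N by apply: ltn_expl.
have divE : ((p * m + r) %/ p = m)%N by rewrite mulnC divnMDl // divn_small ?addn0.
rewrite (big_digits _ phi0 lt_m) (@big_digits _ _ _ _ _ m.+1) //; last first.
  rewrite expnS; apply: leq_trans (_ : p * m.+1 <= _)%N; last by rewrite leq_pmul2l.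
  by rewrite mulnSr ltn_add2l.
rewrite big_nat_recl // expn0 divn1; congr (op (phi _) _).
  by rewrite mulnC modnMDl modn_small.
by apply: eq_bigr => i _; rewrite expnS divnMA divE.
Qed.

Lemma digit_sum_cons m r : (r < p)%N ->
  digit_sum p (p * m + r) = (r + digit_sum p m)%N.
Proof. by move=> lt_rp; rewrite /digit_sum (big_digits_cons _ (phi := id)). Qed.

Definition digit_factn n := (\prod_(d <- digits p n) d`!)%N.

Lemma digit_factE n : digit_fact p n = (digit_factn n)%:R.
Proof. by rewrite /digit_fact -natr_prod. Qed.

Lemma digit_factn_cons m r : (r < p)%N ->
  digit_factn (p * m + r) = (r`! * digit_factn m)%N.
Proof. by move=> lt_rp; rewrite /digit_factn (big_digits_cons _ (phi :=
  factorial)). Qed.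

Lemma digit_sum0 : digit_sum p 0 = 0%N.
Proof. by rewrite /digit_sum (@big_digits _ _ _ id _ 0) // big_geq. Qed.

Lemma digit_factn0 : digit_factn 0 = 1%N.
Proof. by rewrite /digit_factn (@big_digits _ _ _ factorial _ 0) // big_geq. Qed.

Lemma digit_ind (Q : nat -> Prop) : Q 0%N ->
  (forall m r, (r < p)%N -> Q m -> Q (p * m + r)%N) -> forall n, Q n.
Proof.
move=> Q0 Qc; elim/ltn_ind => n IHn; case: (posnP n) => [->//|n_gt0].
rewrite (divn_eq n p) mulnC; apply: Qc; first exact: ltn_pmod.
by apply: IHn; rewrite ltn_Pdiv.
Qed.

Lemma digit_sum_eq0 n : (digit_sum p n == 0%N) = (n == 0%N).
Proof.
apply/eqP/eqP => [|->]; last exact: digit_sum0.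
elim/digit_ind: n => // m r lt_rp IHm; rewrite digit_sum_cons // => /eqP.
by rewrite addn_eq0 => /andP[/eqP-> /eqP/IHm->]; rewrite muln0.
Qed.

(** Least significant digit first, as in [digits]. *)
Definition digits_value (w : seq 'I_p) : nat :=
  foldr (fun (d : 'I_p) n => d + p * n)%N 0%N w.

Lemma digits_valueK n : digits_value (digits p n) = n.
Proof.
have val_map w : digits_value w = foldr (fun d n => d + p * n)%N 0%N (map val w).
  by elim: w => //= d w ->.
rewrite val_map val_digits //.
have: (n < p ^ (trunc_log p n).+1)%N by apply: trunc_log_ltn.
move: (trunc_log p n).+1 => K; elim: K n => [|K IHK] n.
  by rewrite expn0 ltnS leqn0 => /eqP->.
move=> lt_n; rewrite /mkseq /= expn0 divn1 -[1%N]addn0 iotaDl -map_comp.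
rewrite (eq_map (_ : _ =1 fun i => n %/ p %/ p ^ i %% p)%N); last first.
  by move=> i /=; rewrite add1n expnS divnMA.
rewrite IHK; first by rewrite addnC mulnC -divn_eq.
by rewrite ltn_divLR // mulnC -expnS.
Qed.

End Digits.

(** * Sums of powers of p *)

Section PowersOfPpow.
Variable p : nat.
Hypothesis p_pr : prime p.
Let p_gt0 : (0 < p)%N := prime_gt0 p_pr.
Let p_gt1 : (1 < p)%N := prime_gt1 p_pr.
Variable R : comNzRingType.
Local Notation H := (ppow_series p R).

Lemma cf_XnM_subXp d g m r : (d < p)%N -> (r < p)%N ->
  cf (fpsX ^+ d * fps_subXp p g : fps R) (p * m + r) = if d == r then cf g m else 0.
Proof.
move=> lt_dp lt_rp; rewrite cfXnM cf_subXp; case: eqP => [<- | ne_dr].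
  by rewrite ltnNge leq_addl /= addnK dvdn_mulr // mulKn.
case: ltnP => // le_dn; case: ifP => // /dvdnP[q def_q]; case: ne_dr.
have : ((p * m + r) %% p = d %% p)%N by rewrite -(subnK le_dn) def_q modnMDl.
by rewrite mulnC modnMDl !modn_small.
Qed.

Lemma cf_XpM_subXp g m r : (r < p)%N ->
  cf (fpsX ^+ p * fps_subXp p g : fps R) (p * m + r) =
  if r == 0%N then cf (fpsX * g) m else 0.
Proof.
move=> lt_rp; rewrite -fps_subXpX // -fps_subXpM // -[LHS](mul1r) -cf_fpsCM.
rewrite rmorph1 -(expr0 fpsX) cf_XnM_subXp // eq_sym.
by case: eqP => // _.
Qed.

Lemma cf_ppow_exp_digit s m r : (s < p)%N -> (r < p)%N ->
  cf (H ^+ s) (p * m + r) = if (r <= s)%N then 'C(s, r)%:R *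
    cf (H ^+ (s - r)) m else 0.
Proof.
move=> lt_sp lt_rp; rewrite {1}ppow_series_rec // addrC exprDn cf_sum.
rewrite (eq_bigr (fun i : 'I_s.+1 =>
  if i == r :> nat then 'C(s, r)%:R * cf (H ^+ (s - r)) m else 0)); last first.
  move=> i _; rewrite cfMn mulrC -fps_subXpXn // cf_XnM_subXp //; last first.
    by apply: leq_ltn_trans lt_sp; rewrite -ltnS.
  by case: eqP => [<-|_]; rewrite ?mul0rn // mulr_natl.
case: leqP => [le_rs | lt_sr].
  rewrite (bigD1 (Ordinal (le_rs : r < s.+1)%N)) //= eqxx big1 ?addr0 // => i ne_i.
  by rewrite ifN.
rewrite big1 // => i _; rewrite ifN // neq_ltn; apply/orP; left.
by apply: leq_trans lt_sr.
Qed.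

(** The coefficient counts the writings of [n] as a sum of [s] powers of [p].
    When [s < p] no carry is possible and it is a multinomial coefficient of the
    base [p] digits, here multiplied by its denominator. *)
Lemma cf_ppow_exp s n : (s < p)%N ->
  (digit_factn p n)%:R * cf (H ^+ s) n = s`!%:R * (digit_sum p n == s)%:R.
Proof.
elim/(@digit_ind p p_gt1): n s => [|m r lt_rp IHm] s lt_sp.
  rewrite digit_factn0 // digit_sum0 // mul1r cfX0 cf_ppow0 expr0n eq_sym.
  by case: s lt_sp => [|s] _; rewrite ?mulr1 ?mulr0.
rewrite cf_ppow_exp_digit // digit_factn_cons // digit_sum_cons //.
case: leqP => [le_rs | lt_sr]; last first.
  by rewrite mulr0 eqn_leq [(_ <= s)%N]leqNgt (leq_trans lt_sr) ?leq_addr // mulr0.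
rewrite natrM.
transitivity ('C(s, r)%:R * r`!%:R * ((digit_factn p m)%:R * cf (H ^+ (s - r)) m)).
  by ring.
rewrite (IHm _ (leq_ltn_trans (leq_subr _ _) lt_sp)) -(bin_fact le_rs) !natrM
  !mulrA.
congr (_ * (nat_of_bool _)%:R).
by rewrite -{2}(subnKC le_rs) eqn_add2l.
Qed.

(** Among [p] powers of [p] a carry occurs only if all are equal; the sums
    [p p ^ i = p ^ (i + 1)] account for [H (X ^ p)]. *)
Lemma cf_ppow_expp n :
  (digit_factn p n)%:R * cf (H ^+ p - fps_subXp p H) n =
  p`!%:R * (digit_sum p n == p)%:R.
Proof.
elim/(@digit_ind p p_gt1): n => [|m r lt_rp IHm].
  rewrite digit_factn0 // digit_sum0 // mul1r -[LHS]/(cf _ 0 - cf _ 0).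
  rewrite cfX0 cf_subXp0 cf_ppow0 expr0n (gtn_eqF p_gt0) subrr eq_sym (gtn_eqF
    p_gt0).
  by rewrite mulr0.
have expandE : cf (H ^+ p) (p * m + r) =
    (if r == 0%N then cf fpsX m else 0) + 'C(p, r)%:R * cf (H ^+ (p - r)) m.
  rewrite {1}ppow_series_rec // exprDn big_ord_recl -[LHS]/(cf _ _ + cf _ _).
  rewrite bin0 subn0 mulr1n -fps_subXpXn // cf_XpM_subXp // mulr1; congr (_ + _).
  have lt_qp : (p - r.+1 < p)%N by rewrite ltn_subrL p_gt0.
  rewrite cf_sum (bigD1 (Ordinal lt_qp)) //= big1 => [|i ne_i].
    rewrite -[bump 0 _]/(_.+1) -subSn // subSS addr0 cfMn -fps_subXpXn //
      cf_XnM_subXp //; last first.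
      by rewrite ltn_subrL p_gt0 subn_gt0 lt_rp.
    by rewrite subKn 1?ltnW // eqxx bin_sub 1?ltnW // mulr_natl.
  rewrite -[bump 0 _]/(_.+1) cfMn -fps_subXpXn // cf_XnM_subXp ?ltn_subrL ?p_gt0 //.
  rewrite ifN ?mul0rn //; apply: contraNneq ne_i => def_r.
  by apply/eqP/val_inj => /=; rewrite -def_r -subSn // subSS subKn // ltnW.
rewrite digit_factn_cons // digit_sum_cons // -[cf (_ - _) _]/(cf _ _ - cf _ _)
  expandE.
rewrite cf_subXp; have [r0 | nz_r] := eqVneq r 0%N.
  rewrite {}r0 in lt_rp expandE *.
  rewrite addn0 dvdn_mulr // mulKn // bin0 mul1r mul1n subn0 add0n -IHm;
    congr (_ * _).
  have -> : cf H m = cf fpsX m + cf (fps_subXp p H) m by rewrite {1}ppow_series_rec.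
  rewrite -[cf (_ - _) m]/(cf (H ^+ p) m - cf (fps_subXp p H) m).
  by ring.
rewrite dvdn_addr ?dvdn_mulr // gtnNdvd ?lt0n // subr0 add0r.
rewrite natrM.
transitivity ('C(p, r)%:R * r`!%:R * ((digit_factn p m)%:R * cf (H ^+ (p - r)) m)).
  by ring.
have lt_pr : (p - r < p)%N by rewrite ltn_subrL p_gt0 lt0n nz_r.
rewrite (cf_ppow_exp _ lt_pr) -(bin_fact (ltnW lt_rp)) !natrM !mulrA.
congr (_ * (nat_of_bool _)%:R).
by rewrite -(eqn_add2l r) subnKC // ltnW.
Qed.
End PowersOfPpow.

(** * Bernoulli numbers and binomial coefficients modulo p *)

Section Bernoulli.

Lemma bernoulliE n :
  bernoulli n =
  ((n == 0%N)%:R - \sum_(j < n) 'C(n.+1, j)%:R * bernoulli j) / n.+1%:R.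
Proof.
have size_b m : size (bernoulli_seq m) = m.
  by elim: m => //= m IHm; rewrite size_rcons IHm.
have nth_b m i : (i < m)%N -> (bernoulli_seq m)`_i = bernoulli i.
  elim: m => // m IHm; rewrite ltnS leq_eqVlt => /predU1P[-> // | lt_im].
  by rewrite /= nth_rcons size_b lt_im IHm.
rewrite {1}/bernoulli /= nth_rcons size_b ltnn eqxx.
by congr ((_ - _) / _); apply: eq_bigr => j _; rewrite nth_b.
Qed.

Lemma bernoulli_sum n : \sum_(j < n.+1) 'C(n.+1, j)%:R *
  bernoulli j = (n == 0%N)%:R.
Proof.
rewrite big_ord_recr /= [bernoulli n]bernoulliE binSn mulrC divfK ?pnatr_eq0 //.
by rewrite addrC subrK.
Qed.

Variable p : nat.
Hypothesis p_pr : prime p.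

Lemma zloc_invn n : (0 < n < p)%N -> n%:R^-1 \in zloc_pred p.
Proof.
case/andP=> n_gt0 lt_np; rewrite -[_^-1]mul1r -[1]/(1%:~R) pmulrn.
apply: zloc_frac; first by rewrite eqz_nat -lt0n.
by rewrite coprimezE /= prime_coprime // gtnNdvd.
Qed.

Lemma bernoulli_integral n : (n.+1 < p)%N -> bernoulli n \in zloc_pred p.
Proof.
elim/ltn_ind: n => n IHn lt_np; rewrite bernoulliE rpredM ?zloc_invn //.
rewrite rpredB ?rpred_nat // rpred_sum // => j _.
by rewrite rpredM ?rpred_nat // IHn //; apply: leq_ltn_trans lt_np;
  rewrite ltnS ltnW.
Qed.

Lemma bernoulli_sum_Fp n : (n.+1 < p)%N ->
  \sum_(j < n.+1) 'C(n.+1, j)%:R * ratr (bernoulli j) = (n == 0%N)%:R :> 'F_p.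
Proof.
move=> lt_np; have Zb (j : 'I_n.+1) : bernoulli j \in zloc_pred p.
  by apply: bernoulli_integral; apply: leq_ltn_trans lt_np; apply: ltn_ord.
have : \sum_(j < n.+1) 'C(n.+1, j)%:R * Zloc (Zb j) = (n == 0%N)%:R.
  apply: zval_inj; rewrite rmorph_sum rmorph_nat -bernoulli_sum.
  by apply: eq_bigr => j _; rewrite rmorphM rmorph_nat.
move/(congr1 (zred p_pr)); rewrite rmorph_sum rmorph_nat => <-.
by apply: eq_bigr => j _; rewrite rmorphM rmorph_nat.
Qed.

End Bernoulli.

Section Binomials.
Variable p : nat.
Hypothesis p_pr : prime p.
Let p_gt0 : (0 < p)%N := prime_gt0 p_pr.

Lemma natr_Fp_eq0 n : (n%:R == 0 :> 'F_p) = (p %| n)%N.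
Proof. by rewrite -(dvdn_pcharf (pchar_Fp p_pr)). Qed.

Lemma natr_Fp_neq0 n : (0 < n < p)%N -> n%:R != 0 :> 'F_p.
Proof. by case/andP=> n_gt0 lt_np; rewrite natr_Fp_eq0 gtnNdvd. Qed.

Lemma fact_Fp_neq0 n : (n < p)%N -> n`!%:R != 0 :> 'F_p.
Proof.
elim: n => [|n IHn] lt_np; first by rewrite oner_eq0.
by rewrite factS natrM mulf_neq0 // ?IHn ?(ltnW lt_np) // natr_Fp_neq0.
Qed.

Lemma natr_compl_Fp n : (n <= p)%N -> (p - n)%:R = - n%:R :> 'F_p.
Proof. by move=> le_np; rewrite natrB // natr_p_Fp // sub0r. Qed.

Lemma fact_pred_Fp : (p.-1)`!%:R = -1 :> 'F_p.
Proof.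
apply/eqP; rewrite -subr_eq0 opprK natr1 natr_Fp_eq0.
by rewrite -Wilson ?prime_gt1.
Qed.

(** Wilson's theorem, moving one factor [p - 1 - b = - (b + 1)] at a time. *)
Lemma fact_compl b : (b < p)%N -> b`!%:R * (p.-1 - b)`!%:R = (-1) ^+ b.+1 :> 'F_p.
Proof.
elim: b => [|b IHb] lt_bp; first by rewrite subn0 mul1r fact_pred_Fp.
have nz_b : - (b.+1)%:R != 0 :> 'F_p by rewrite oppr_eq0 natr_Fp_neq0.
apply: (mulfI nz_b); rewrite exprS mulN1r mulrN -IHb 1?ltnW // factS natrM.
have def_b : (p.-1 - b = (p.-1 - b.+1).+1)%N by lia.
have -> : (p.-1 - b)`!%:R = - b.+1%:R * (p.-1 - b.+1)`!%:R :> 'F_p.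
  rewrite def_b factS natrM -def_b -natr_compl_Fp 1?ltnW //; congr (_%:R * _); lia.
by ring.
Qed.

(** Replace each factorial by that of its complement to [p - 1]. *)
Lemma bin_reflect a b : (b <= a < p)%N ->
  'C(a, b)%:R = (-1) ^+ (a - b) * 'C(p.-1 - b, p.-1 - a)%:R :> 'F_p.
Proof.
case/andP=> le_ba lt_ap; have lt_bp := leq_ltn_trans le_ba lt_ap.
have le_pp : (p.-1 - a <= p.-1 - b)%N by apply: leq_sub2l.
have nz : b`!%:R * (a - b)`!%:R * (p.-1 - a)`!%:R != 0 :> 'F_p.
  by rewrite !mulf_neq0 ?fact_Fp_neq0 //; lia.
apply: (mulIf nz).
have -> : 'C(a, b)%:R * (b`!%:R * (a - b)`!%:R *
  (p.-1 - a)`!%:R) = (-1) ^+ a.+1 :> 'F_p.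
  by rewrite -(fact_compl lt_ap) -(bin_fact le_ba) !natrM !mulrA.
have -> : (-1) ^+ (a - b) * 'C(p.-1 - b, p.-1 - a)%:R *
     (b`!%:R * (a - b)`!%:R * (p.-1 - a)`!%:R) = (-1) ^+ (a - b) *
       (-1) ^+ b.+1 :> 'F_p.
  rewrite -(fact_compl lt_bp) -(bin_fact le_pp) !natrM.
  have ->: (p.-1 - b - (p.-1 - a) = a - b)%N by lia.
  by ring.
by rewrite -exprD; congr (_ ^+ _); lia.
Qed.

Lemma bin_pred_Fp k : odd p -> (k < p)%N -> 'C(p.-1, k)%:R = (-1) ^+ k :> 'F_p.
Proof.
move=> p_odd lt_kp; rewrite bin_reflect ?subnn ?bin0 ?mulr1; last by lia.
have even_p1 : odd p.-1 = false by rewrite -[odd _]negbK -oddS prednK // p_odd.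
by rewrite -signr_odd oddB ?even_p1 ?signr_odd //; lia.
Qed.
End Binomials.

(** * Stirling numbers divided by p *)

Section RisingShift.
Variable R : comNzRingType.

Lemma rising_recr n : rising R n.+1 = rising R n * ('X + n%:R).
Proof. by rewrite /rising big_ord_recr. Qed.

Lemma rising_comp n : rising R n.+1 \Po ('X - 1%:P) = ('X - 1%:P) * rising R n.
Proof.
rewrite /rising big_ord_recl addr0 comp_polyM comp_polyX; congr (_ * _).
rewrite rmorph_prod; apply: eq_bigr => e _.
rewrite rmorphD /= comp_polyX -polyC_natr comp_polyC polyC_natr -[bump 0 e]/(e.+1).
by rewrite polyC1 mulrS addrA subrK.
Qed.

Lemma rising_diff n :
  rising R n.+1 - (rising R n.+1 \Po ('X - 1%:P)) = n.+1%:R * rising R n.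
Proof. by rewrite rising_comp rising_recr -nat1r polyC1; ring. Qed.

Lemma rising_quotient_diff n (g : {poly R}) :
    rising R n.+1 = 'X^(n.+1) - 'X + n.+1%:R * g ->
  n.+1%:R * (g - (g \Po ('X - 1%:P))) =
  n.+1%:R * rising R n - 'X^(n.+1) + ('X - 1%:P) ^+ n.+1 + 1.
Proof.
move=> def_g; rewrite -rising_diff def_g !rmorphD rmorphN rmorphXn rmorphM
  rmorph_nat /=.
by rewrite comp_polyX polyC1; ring.
Qed.
End RisingShift.

Lemma sum_nat_delta (R : comNzRingType) a b t (c : nat -> R) : (a <= t < b)%N ->
  \sum_(a <= s < b) (s == t)%:R * c s = c t.
Proof.
case/andP=> le_at lt_tb; rewrite (@big_cat_nat _ _ _ t) //=; last exact: ltnW.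
rewrite big_nat big1 => [|s /andP[_ lt_st]]; last by rewrite (ltn_eqF lt_st) mul0r.
rewrite add0r big_ltn // eqxx mul1r big_nat big1 ?addr0 // => s /andP[lt_ts _].
by rewrite (gtn_eqF lt_ts) mul0r.
Qed.

Section StirlingBernoulli.
Variable p : nat.
Hypotheses (p_pr : prime p) (p_odd : odd p).
Let p_gt0 : (0 < p)%N := prime_gt0 p_pr.
Let p_gt1 : (1 < p)%N := prime_gt1 p_pr.
Let p_gt2 : (2 < p)%N := odd_prime_gt2 p_odd p_pr.
Local Notation red := (zred p_pr).

(** Seeing [c] as a polynomial, these equations say that [c (x) - c (x - 1)] has
    coefficient [1 / k] in degree [k], for [1 <= k <= p - 2]; being triangular,
    they determine the coefficients of [c] in degrees 2 to [p - 1]. *)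
Definition backward_eqs (c : nat -> 'F_p) :=
  forall k, (0 < k)%N -> (k.+1 < p)%N ->
    - (k%:R * \sum_(k.+1 <= s < p) c s * ('C(s, k)%:R * (-1) ^+ (s - k))) = 1.

Lemma backward_eqs_uniq c1 c2 : backward_eqs c1 -> backward_eqs c2 ->
  forall s, (1 < s < p)%N -> c1 s = c2 s.
Proof.
move=> eq1 eq2 s; have [n] := ubnP (p - s);
  elim: n s => // n IHn [|[|k]] // ltn lt_sp.
have nz_k : k.+1%:R != 0 :> 'F_p by rewrite natr_Fp_neq0 //; lia.
have := etrans (eq1 k.+1 isT lt_sp) (esym (eq2 k.+1 isT lt_sp)).
move/oppr_inj/(mulfI nz_k); rewrite !(big_ltn lt_sp) !big_nat.
rewrite (eq_bigr (fun s => c2 s * ('C(s, k.+1)%:R * (-1) ^+ (s - k.+1))));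
  last first.
  by move=> s /andP[lt_ks s_p]; rewrite IHn //; lia.
move/addIr; apply: mulIf; rewrite mulf_neq0 ?signr_eq0 // binSn.
by rewrite natr_Fp_neq0 //; lia.
Qed.

(** By [k C(s, k) = s C(s - 1, k - 1)] and reflection of binomial coefficients,
    this is the recurrence of the Bernoulli numbers of order [p - k]. *)
Lemma backward_eqs_lambda : backward_eqs (lambda p).
Proof.
move=> k k_gt0 lt_kp; rewrite mulr_sumr.
have term s : (k.+1 <= s < p)%N ->
    k%:R * (lambda p s * ('C(s, k)%:R * (-1) ^+ (s - k))) =
    'C(p - k, p - s)%:R * ratr (bernoulli (p - s)).
  case/andP=> lt_ks lt_sp; have nz_s : s%:R != 0 :> 'F_p.
    by rewrite natr_Fp_neq0 //; lia.
  rewrite /lambda ifN; last by lia.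
  have eqC : k%:R * 'C(s, k)%:R = s%:R * 'C(s.-1, k.-1)%:R :> 'F_p.
    by rewrite -!natrM mul_bin_diag prednK.
  have := bin_reflect p_pr (_ : k.-1 <= s.-1 < p)%N.
  have -> : (s.-1 - k.-1 = s - k)%N by lia.
  have -> : (p.-1 - k.-1 = p - k)%N by lia.
  have -> : (p.-1 - s.-1 = p - s)%N by lia.
  move=> reflC; rewrite reflC in eqC; last by lia.
  have sgn2 : (-1) ^+ (s - k) * (-1) ^+ (s - k) = 1 :> 'F_p.
    by rewrite -exprD addnn -[LHS]signr_odd odd_double.
  transitivity (k%:R * 'C(s, k)%:R * (ratr (bernoulli (p - s)) / s%:R *
    (-1) ^+ (s - k)) : 'F_p).
    by ring.
  rewrite eqC; move: sgn2; set e := _ ^+ _ => sgn2.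
  transitivity (e * e * ('C(p - k, p - s)%:R * ratr (bernoulli (p - s))) : 'F_p).
    by field.
  by rewrite sgn2 mul1r.
rewrite big_nat (eq_bigr _ term) -big_nat big_nat_rev /=.
rewrite -[k.+1]add1n big_addn.
have := @bernoulli_sum_Fp p p_pr (p - k).-1.
rewrite prednK; last by lia.
rewrite (_ : (_ == 0%N) = false); last by lia.
move=> /(_ _)/eqP; rewrite -(big_mkord xpredT (fun j =>
  'C(p - k, j)%:R * ratr (bernoulli j))).
rewrite big_ltn; last by lia.
rewrite bin0 mul1r bernoulliE big_ord0 subr0 divr1 -[1%:R]/(1%:~R) ratr_int
  addrC addr_eq0.
move=> sumB; apply: oppr_inj; rewrite opprK -(eqP (sumB _)); last by lia.
apply: congr_big_nat => // i /andP[i_gt0 lt_i].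
by congr ('C(_, _)%:R * ratr (bernoulli _)); lia.
Qed.

Lemma coef_Xsub1_exp (R : comNzRingType) s k :
  (('X - 1%:P : {poly R}) ^+ s)`_k = 'C(s, k)%:R * (-1) ^+ (s - k).
Proof.
elim: s k => [|s IHs] k.
  by rewrite expr0 coef1 bin0n sub0n mulr1.
rewrite exprS polyC1 mulrBl mul1r coefB coefXM !IHs; case: k => [|k] /=.
  by rewrite !bin0 !subn0 exprS !mul1r sub0r mulN1r.
rewrite subSS binS natrD mulrDl; have [le_sk | lt_ks] := leqP s k.
  by rewrite [('C(s, k.+1))]bin_small // !mul0r subr0 add0r.
have ->: (s - k = (s - k.+1).+1)%N by lia.
by rewrite exprS; ring.
Qed.

Lemma rising_pred_Fp k : (0 < k < p)%N -> (rising 'F_p p.-1)`_k = 1.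
Proof.
have nz : 'X - 1%:P != 0 :> {poly 'F_p} by rewrite polyXsubC_eq0.
have -> : rising 'F_p p.-1 = 'X * \sum_(i < p.-1) 'X^i.
  apply: (mulfI nz); rewrite polyC1 mulrCA -subrX1 mulrBr mulr1 -exprS prednK //.
  have := rising_recr 'F_p p.-1; rewrite prednK // rising_Fp // => ->.
  rewrite mulrC; congr (_ * (_ + _)).
  by rewrite -polyC_natr -subn1 natr_compl_Fp // polyCN.
case/andP=> k_gt0 lt_kp; rewrite coefXM gtn_eqF // coef_sum.
have lt_k1 : (k.-1 < p.-1)%N by lia.
rewrite (bigD1 (Ordinal lt_k1)) //= coefXn eqxx big1 ?addr0 // => i ne_i.
rewrite coefXn; case: eqP => // eq_i; case/eqP: ne_i.
by apply: val_inj; rewrite /= eq_i.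
Qed.

Variable g : {poly zloc p}.
Hypotheses (size_g : (size g <= p)%N)
           (def_g : rising _ p = 'X^p - 'X + p%:R * g).

(** From the backward difference of the rising factorial, a multiple of [p], one
    gets modulo [p] the coefficient [1 + 1 / k] for [g] itself; the added monomial
    [x ^ (p - 1)] removes the [1]. *)
Lemma backward_eqs_quotient :
  backward_eqs (fun s => red g`_s + (s == p.-1)%:R).
Proof.
move=> k k_gt0 lt_kp.
have lt_kp' := ltnW lt_kp.
have [k_p1 kp] : (k == p.-1) = false /\ (k == p) = false by lia.
(* The coefficient of X ^ k in the difference equation is multiplied by k so
   that k C(p, k) = p C(p - 1, k - 1) allows the division by p. *)
have eq_k : k%:R * (g`_k - (g \Po ('X - 1%:P))`_k) =
    k%:R * (rising _ p.-1)`_k + 'C(p.-1, k.-1)%:R * (-1) ^+ (p - k).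
  apply: (zloc_p_inj p_pr).
  have := @rising_quotient_diff (zloc p) p.-1 g; rewrite prednK // => /(_ def_g).
  move/(congr1 (fun q : {poly _} => q`_k)).
  rewrite /= -[p%:R]polyC_natr coefCM coefB !coefD coefN coefCM coefXn kp oppr0
    addr0.
  rewrite coef1 gtn_eqF // addr0 coef_Xsub1_exp mulrCA => ->.
  rewrite !mulrDr mulrCA; congr (_ + _); rewrite !mulrA; congr (_ * _).
  by rewrite -!natrM mul_bin_diag prednK // mulnC.
have := congr1 red eq_k.
rewrite !(rmorphM, rmorphB, rmorphD) !rmorph_nat rmorph_sign /=.
rewrite -(coef_map red (rising _ _)) map_rising rising_pred_Fp ?k_gt0 // mulr1.
rewrite bin_pred_Fp //; last by lia.
have ->: (-1) ^+ k.-1 * (-1) ^+ (p - k) = 1 :> 'F_p.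
  rewrite -exprD -signr_odd (_ : k.-1 + (p - k) = p.-1)%N; last by lia.
  by rewrite -[odd _]negbK -oddS prednK // p_odd.
pose c s := 'C(s, k)%:R * (-1) ^+ (s - k) : 'F_p.
have -> : red (g \Po ('X - 1%:P))`_k = \sum_(k <= s < p) red g`_s * c s.
  rewrite coef_comp_poly rmorph_sum /=.
  rewrite (eq_bigr (fun i : 'I__ => red g`_i * c i)); last first.
    by move=> i _; rewrite rmorphM coef_Xsub1_exp rmorphM rmorph_nat rmorph_sign.
  rewrite (big_ord_widen p (fun i => red g`_i * c i) size_g) big_mkcond /=.
  rewrite -(big_mkord xpredT (fun i =>
    if (i < size g)%N then red g`_i * c i else 0)).
  rewrite (@big_cat_nat _ _ _ k) 1?ltnW //= big_nat big1 ?add0r =>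
    [|i /andP[_ lt_ik]].
    apply: eq_bigr => i _; case: ltnP => // le_gi.
    by rewrite nth_default // rmorph0 mul0r.
  by rewrite /c bin_small // mul0r mulr0 if_same.
have ck1 : c k = 1 by rewrite /c binn subnn mulr1.
rewrite (big_ltn lt_kp') ck1 mulr1 opprD addrA subrr add0r => eq_c.
rewrite (eq_bigr (fun s => red g`_s * c s + (s == p.-1)%:R * c s)); last first.
  by move=> s _; rewrite mulrDl.
rewrite big_split /= sum_nat_delta; last by lia.
have -> : c p.-1 = 1.
  rewrite /c bin_pred_Fp // -exprD -signr_odd (_ : k + (p.-1 - k) = p.-1)%N;
    last by lia.
  by rewrite -[odd _]negbK -oddS prednK // p_odd.
rewrite mulrDr opprD mulr1 -mulrN eq_c.
by rewrite addrAC subrr add0r.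
Qed.

Lemma quotient_coef0 : g`_0 = 0.
Proof.
apply: (zloc_p_inj p_pr); have /(congr1 (fun q : {poly _} => q`_0)) := def_g.
have -> : rising (zloc p) p = 'X * \prod_(1 <= e < p) ('X + e%:R).
  by rewrite /rising -(big_mkord xpredT (fun e => 'X + e%:R)) big_ltn // addr0.
rewrite coefXM /= coefD coefB coefXn coefX (ltn_eqF p_gt0) subr0 add0r.
by rewrite -polyC_natr coefCM mulr0.
Qed.

Lemma quotient_coef1 : red g`_1 = lambda p 1.
Proof.
pose w := ((p.-1)`!.+1 %/ p)%N.
have def_w : ((p.-1)`!.+1 = p * w)%N by rewrite mulnC divnK // -Wilson.
suff -> : g`_1 = w%:R by rewrite rmorph_nat.
apply: (zloc_p_inj p_pr); rewrite -natrM -def_w.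
have /(congr1 (fun q : {poly _} => q`_1)) := def_g.
have -> : rising (zloc p) p = 'X * \prod_(1 <= e < p) ('X + e%:R).
  by rewrite /rising -(big_mkord xpredT (fun e => 'X + e%:R)) big_ltn // addr0.
rewrite coefXM /= coefD coefB coefXn coefX (ltn_eqF p_gt1) sub0r.
rewrite -[p%:R in RHS]polyC_natr coefCM -horner_coef0 horner_prod => eq1.
rewrite -natr1; apply: (addrI (-1)); rewrite -eq1 addrC addrK.
rewrite fact_prod natr_prod prednK //; apply: eq_bigr => e _.
by rewrite hornerD hornerX -polyC_natr hornerC add0r.
Qed.

(** The correction in degree [p - 1] is the difference between the two sign
    conventions for the Bernoulli number of index 1. *)
Lemma quotient_lambda s : (0 < s < p)%N ->
  red g`_s + (s == p.-1)%:R = lambda p s.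
Proof.
case/andP=> s_gt0 lt_sp; have [->|ne_s1] := eqVneq s 1%N.
  by rewrite quotient_coef1 (_ : (1 == p.-1)%N = false) ?addr0 //; lia.
apply: (backward_eqs_uniq backward_eqs_quotient backward_eqs_lambda); lia.
Qed.
End StirlingBernoulli.

(** * Factorization of the series W *)

Section RhoSeries.
Variable p : nat.
Hypotheses (p_pr : prime p) (p_odd : odd p).
Let p_gt0 : (0 < p)%N := prime_gt0 p_pr.
Let p_gt1 : (1 < p)%N := prime_gt1 p_pr.
Let p_gt2 : (2 < p)%N := odd_prime_gt2 p_odd p_pr.
Local Notation h := (ppow_series p 'F_p).

Lemma digit_fact_neq0 n : digit_fact p n != 0.
Proof. by rewrite /digit_fact prodf_seq_neq0; apply/allP => d _;
  apply: fact_Fp_neq0. Qed.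

Lemma cf_exp_ppow_Fp s n : (s < p)%N ->
  cf (h ^+ s) n = (s == digit_sum p n)%:R * (s`!%:R / digit_fact p n).
Proof.
move=> lt_sp; apply: (mulfI (digit_fact_neq0 n)).
rewrite {1}digit_factE cf_ppow_exp // eq_sym mulrCA [digit_fact p n * _]mulrCA.
by rewrite divff ?digit_fact_neq0 // mulr1 mulrC.
Qed.

Lemma cf_ppow_quotient (J : fps (zloc p)) n :
    ppow_series p _ ^+ p = fps_subXp p (ppow_series p _) + p%:R * J ->
  cf (fps_map (zred p_pr) J) n = - (digit_sum p n == p)%:R / digit_fact p n.
Proof.
move=> def_J; apply: (mulfI (digit_fact_neq0 n));
  rewrite [RHS]mulrC divfK ?digit_fact_neq0 //.
have := cf_ppow_expp p_pr (zloc p) n; rewrite def_J addrC addKr cf_natM.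
have -> : (p`! = p * (p.-1)`!)%N by rewrite -{1}(prednK p_gt0) factS prednK.
rewrite natrM mulrCA -mulrA => /(zloc_p_inj p_pr) /(congr1 (zred p_pr)).
rewrite !rmorphM !rmorph_nat /= fact_pred_Fp // digit_factE => ->.
by rewrite mulN1r.
Qed.

(** The function [rho] when digits of sum [s] have already been read, up to the
    factorials of these digits. *)
Definition rho_shift (s n : nat) : 'F_p :=
  if (s + digit_sum p n <= p)%N
  then omega p (s + digit_sum p n) / digit_fact p n else 0.

Lemma rho_shift0 n : rho_shift 0 n = rho p n.
Proof.
rewrite /rho_shift /rho /omega add0n digit_sum_eq0 //; case: eqP => [_|_].
  by rewrite mul0r if_same.
set s := digit_sum p n; case: (leqP s p.-1) => [le_s | lt_s].
  by rewrite (leq_trans le_s) ?leq_pred.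
rewrite prednK // in lt_s; by rewrite eqn_leq lt_s andbT.
Qed.

Lemma rho_seriesE (g : {poly zloc p}) (J : fps (zloc p)) :
    (size g <= p)%N -> rising _ p = 'X^p - 'X + p%:R * g ->
    ppow_series p _ ^+ p = fps_subXp p (ppow_series p _) + p%:R * J ->
  fps_eval h (map_poly (zred p_pr) g) + h ^+ p.-1 + fps_map (zred p_pr) J =
  Fps (rho p).
Proof.
move=> size_g def_g def_J; apply/fpsP => n;
  rewrite -[LHS]/(cf _ n + cf _ n + cf _ n).
rewrite (cf_ppow_quotient _ def_J) -[RHS]/(rho p n) -rho_shift0 /rho_shift add0n.
have lt_p1 : (p.-1 < p)%N by rewrite prednK.
rewrite (@fps_evalE_wide _ _ _ p) ?(leq_trans (size_poly _ _)) //.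
rewrite cf_sum (eq_bigr (fun i : 'I_p => (i == digit_sum p n :> nat)%:R *
   (zred p_pr g`_i * (i`!%:R / digit_fact p n)))); last first.
  by move=> i _; rewrite cf_fpsCM coef_map cf_exp_ppow_Fp // mulrCA.
rewrite cf_exp_ppow_Fp //; set s := digit_sum p n; set f := digit_fact p n.
rewrite -(big_mkord xpredT (fun i =>
  (i == s)%:R * (zred p_pr g`_i * (i`!%:R / f)))).
have [lt_sp | le_ps] := ltnP s p; last first.
  rewrite big_nat big1 ?add0r => [|i /andP[_ lt_ip]]; last first.
    by rewrite ltn_eqF ?mul0r // (leq_trans lt_ip).
  rewrite ltn_eqF ?mul0r ?add0r //; last exact: leq_trans le_ps.
  rewrite [(s <= p)%N]leq_eqVlt [(s < p)%N]ltnNge le_ps orbF.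
  case: eqP => [->|_]; last by rewrite oppr0 mul0r.
  by rewrite /omega (gtn_eqF p_gt0) leqNgt prednK // leqnn.
rewrite sum_nat_delta // (ltnW lt_sp) (ltn_eqF lt_sp) oppr0 mul0r addr0.
have [s0 | s_gt0] := posnP s.
  rewrite s0 quotient_coef0 // rmorph0 mul0r add0r /omega /= mul0r.
  by rewrite (_ : (p.-1 == 0)%N = false) ?mul0r //; lia.
have s_p : (0 < s < p)%N by rewrite s_gt0.
rewrite /omega (gtn_eqF s_gt0) ifT; last by lia.
rewrite -(quotient_lambda p_pr p_odd size_g def_g s_p) 2!mulrDl -!mulrA;
  congr (_ + _).
by rewrite eq_sym; case: eqP => [->|_]; rewrite ?mul0r.
Qed.

Lemma W_series_rho : W_series p = (1 - h ^+ p.-1) * Fps (rho p).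
Proof.
have [g size_g def_g] := rising_quotient p_pr; have [J def_J] := ppow_quotient p_pr.
by rewrite (W_seriesE p_pr p_odd def_g def_J) (rho_seriesE size_g def_g def_J).
Qed.

End RhoSeries.

(** * Digit transitions *)

Section Transitions.
Variable p : nat.
Hypothesis p_pr : prime p.
Let p_gt0 : (0 < p)%N := prime_gt0 p_pr.
Let p_gt1 : (1 < p)%N := prime_gt1 p_pr.
Local Notation B := (ppow_shift p).

Definition rho_series s : fps 'F_p := Fps (rho_shift p s).

Definition state_series (c a s : nat) : fps 'F_p := fpsX ^+ c * (rho_series s *
  B ^+ a).

Lemma cf_XnM_subXp_div e (G : fps 'F_p) m r : (r < p)%N ->
  cf (fpsX ^+ e * fps_subXp p G) (p * m + r) =
  if (e %% p == r)%N then cf (fpsX ^+ (e %/ p)%N * G) m else 0.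
Proof.
move=> lt_rp; rewrite {1}(divn_eq e p) [(_ %/ _ * _ + _)%N]addnC exprD.
rewrite [(_ %/ _ * _)%N]mulnC exprM -(fps_subXpX _ p_gt0).
by rewrite -mulrA -fps_subXpXn // -fps_subXpM // cf_XnM_subXp // ltn_pmod.
Qed.

Lemma ppow_shift_rec : B = 1 + fpsX ^+ p.-1 * fps_subXp p B.
Proof.
apply: (mulfI (fpsX_neq0 _)); rewrite ppow_shiftE mulrDr mulr1 mulrA -exprS
  prednK //.
by rewrite -(fps_subXpX _ p_gt0) -fps_subXpM // ppow_shiftE -ppow_series_rec.
Qed.

Lemma ppow_shift_exp a : B ^+ a =
  \sum_(a' < a.+1) 'C(a, a')%:R * (fpsX ^+ (p.-1 * a') * fps_subXp p (B ^+ a')).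
Proof.
rewrite {1}ppow_shift_rec exprDn; apply: eq_bigr => i _.
by rewrite expr1n mul1r exprMn -exprM fps_subXpXn // mulr_natl.
Qed.

Lemma rho_series_rec s : rho_series s =
  \sum_(d < p | (s + d <= p)%N)
    fpsC (d`!%:R^-1) * (fpsX ^+ d * fps_subXp p (rho_series (s + d))).
Proof.
apply/fpsP => n; rewrite cf_sum (divn_eq n p) [(_ %/ _ * _)%N]mulnC.
move: (n %/ p)%N (n %% p)%N (ltn_pmod n p_gt0) => m r lt_rp.
rewrite big_mkcond (bigD1 (Ordinal lt_rp)) // big1 => [|d ne_dr]; last first.
  by case: ifP => // _; rewrite cf_fpsCM cf_XnM_subXp // ifN ?mulr0.
rewrite cf_fpsCM cf_XnM_subXp // eqxx /= /rho_shift digit_sum_cons // addnA.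
rewrite !digit_factE digit_factn_cons // natrM invfM.
rewrite addr0; case: (leqP (s + r + digit_sum p m) p) => [le_p | _];
  last by rewrite mulr0 if_same.
by rewrite (leq_trans _ le_p) ?leq_addr // mulrCA.
Qed.

(** In the expansion of the state series, the term indexed by [d] and [a'] has
    exponent [c + d + (p - 1) a'] times a series in [X ^ p].  It contributes only
    if the exponent is congruent to the digit [kappa] read, which determines [d],
    and the quotient of the exponent by [p] is the next carry. *)
Lemma state_series_rec (kappa c a : 'I_p) s m :
  cf (state_series c a s) (p * m + kappa) =
  \sum_(a' : 'I_p | (a' <= a)%N)
    let d := E_digit kappa c a' in
    if (s + d <= p)%N then
      'C(a, a')%:R / d`!%:R * cf (state_series (E_carry kappa c a') a' (s + d)) m
    else 0.
Proof.
rewrite /state_series ppow_shift_exp mulr_sumr mulr_sumr cf_sum.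
rewrite (big_ord_widen p (fun i => cf (fpsX ^+ c * (rho_series s *
    ('C(a, i)%:R * (fpsX ^+ (p.-1 * i) * fps_subXp p (B ^+ i))))) (p *
      m + kappa)) (ltn_ord a)).
apply: eq_big => [a' | a' _]; first by rewrite ltnS.
rewrite rho_series_rec mulr_suml mulr_sumr cf_sum.
have lt_dp : (E_digit kappa c a' < p)%N by apply: ltn_pmod.
have carryE := E_carryE kappa c a'; set d0 := Ordinal lt_dp.
pose T d := 'C(a, a')%:R / d`!%:R *
  cf (fpsX ^+ E_carry kappa c a' * (rho_series (s + d) * B ^+ a')) m : 'F_p.
rewrite -/(T (E_digit kappa c a')).
rewrite (eq_bigr (fun d : 'I_p => if d == d0 then T d else 0)).
  rewrite big_mkcond (bigD1 d0) // eqxx big1 /= ?addr0 // => d /negPf->.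
  exact: if_same.
move=> d _.
have -> : fpsX ^+ c * (fpsC (d`!%:R^-1) * (fpsX ^+ d *
  fps_subXp p (rho_series (s + d))) *
      ('C(a, a')%:R * (fpsX ^+ (p.-1 * a') * fps_subXp p (B ^+ a')))) =
    fpsC ('C(a, a')%:R / d`!%:R) *
      (fpsX ^+ (d + p.-1 * a' + c) * fps_subXp p (rho_series (s + d) * B ^+ a')).
  by rewrite fps_subXpM // rmorphM rmorph_nat !exprD; ring.
rewrite cf_fpsCM cf_XnM_subXp_div //.
have [->|ne_d] := eqVneq d d0.
  by rewrite -carryE modnMDl modn_small // eqxx divnMDl // divn_small // addn0.
rewrite ifN ?mulr0 //; apply: contraNneq ne_d => eq_mod.
have : (d + (p.-1 * a' + c) == d0 + (p.-1 * a' + c) %[mod p])%N.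
  by rewrite !addnA eq_mod /= -carryE modnMDl modn_small.
by rewrite eqn_modDr !modn_small // => /eqP/val_inj->.
Qed.

Lemma cf_state_series0 c a s : (s <= p)%N ->
  cf (state_series c a s) 0 = if c == 0%N then omega p s else 0.
Proof.
move=> le_sp; rewrite /state_series !cfM0 !cfX0 /= coefX expr0n.
rewrite /rho_shift digit_sum0 // addn0 le_sp digit_factE digit_factn0 // divr1.
by rewrite logn1 expn0 eqxx expr1n mulr1; case: eqP; rewrite ?mul1r ?mul0r.
Qed.

End Transitions.

(** * The digit procedure and the automaton *)

Section Procedure.
Variable p : nat.
Hypotheses (p_pr : prime p) (p_odd : odd p).
Let p_gt0 : (0 < p)%N := prime_gt0 p_pr.
Let p_gt1 : (1 < p)%N := prime_gt1 p_pr.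
Let lt_p1 : (p.-1 < p)%N. Proof. by rewrite prednK. Qed.

Definition state_value (m : nat) (x : E_state p) : 'F_p :=
  cf (state_series p x.1.1 x.1.2 x.2) m.

Definition next_state (kappa c a' : 'I_p) (s : nat) : E_state p :=
  (Ordinal (E_carry_lt kappa c a'), a', inord (s + E_digit kappa c a')).

Lemma state_value_rec (kappa : 'I_p) m (x : E_state p) :
  state_value (p * m + kappa) x =
  \sum_(a' : 'I_p | (a' <= x.1.2)%N)
    let d := E_digit kappa x.1.1 a' in
    if (x.2 + d <= p)%N then
      'C(x.1.2, a')%:R / d`!%:R * state_value m (next_state kappa x.1.1 a' x.2)
    else 0.
Proof.
apply: etrans (state_series_rec p_pr _ _ _ _ _) _; apply: eq_bigr => a' _ /=.
by case: ifP => // le_p; rewrite /state_value /= inordK.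
Qed.

Lemma E_step_value (v : E_vector p) kappa m :
  \sum_y E_step v kappa y * state_value m y =
  \sum_x v x * state_value (p * m + kappa) x.
Proof.
pose t (x : E_state p) (a' : 'I_p) (y : E_state p) : 'F_p :=
  if [&& (x.2 + E_digit kappa x.1.1 a' <= p)%N,
         y.1.1 == E_carry kappa x.1.1 a' :> nat,
         y.1.2 == a' & y.2 == (x.2 + E_digit kappa x.1.1 a')%N :> nat]
  then v x * 'C(x.1.2, a')%:R / ((E_digit kappa x.1.1 a')`!)%:R else 0.
transitivity (\sum_y \sum_(x : E_state p) \sum_(a' : 'I_p | (a' <= x.1.2)%N)
    t x a' y * state_value m y).
  apply: eq_bigr => y _; rewrite ffunE mulr_suml; apply: eq_bigr => x _.
  by rewrite mulr_suml.
rewrite exchange_big; apply: eq_bigr => x _.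
rewrite exchange_big state_value_rec mulr_sumr; apply: eq_bigr => a' _ /=.
have [le_p | nle_p] := boolP (x.2 + E_digit kappa x.1.1 a' <= p)%N; last first.
  rewrite mulr0 big1 // => y _; rewrite /t (negPf nle_p) mul0r //.
set y0 := next_state _ _ _ _; rewrite (bigD1 y0) //= big1 ?addr0 => [|y ne_y].
  by rewrite /t le_p /= inordK // !eqxx /= !mulrA.
rewrite /t le_p /=; case: ifP; rewrite ?mul0r // => /and3P[/eqP y1 /eqP y2 /eqP y3].
case/eqP: ne_y; case: y y1 y2 y3 => [[c a] s] /= y1 y2 y3.
by congr (_, _, _); [apply: val_inj | | apply: val_inj; rewrite /= y3 inordK].
Qed.

Lemma E_outE (v : E_vector p) : E_out v = \sum_x v x * state_value 0 x.
Proof.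
rewrite /E_out big_mkcond; apply: eq_bigr => x _.
rewrite /state_value cf_state_series0 //; last by rewrite -ltnS.
by case: eqP => _; rewrite ?mulr0 // mulrC.
Qed.

(** A vector of states stands for the corresponding combination of the state
    series, and reading digits extracts one of its coefficients. *)
Lemma E_fold_value (v : E_vector p) (w : seq 'I_p) :
  E_out (foldl (@E_step p) v w) = \sum_x v x * state_value (digits_value w) x.
Proof.
elim: w v => [|d w IHw] v; first exact: E_outE.
by rewrite /= IHw E_step_value addnC.
Qed.

Lemma E_fold_init w :
  E_out (foldl (@E_step p) (E_init p) w) = cf (state_series p 0 p.-1 0)
    (digits_value w).
Proof.
pose x0 : E_state p := (Ordinal p_gt0, Ordinal lt_p1, ord0).
rewrite E_fold_value (bigD1 x0) //= big1 ?addr0 => [|x ne_x].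
  by rewrite ffunE /= !eqxx mul1r.
rewrite ffunE; case: and3P; rewrite ?mul0r // => -[/eqP x1 /eqP x2 /eqP x3].
case/eqP: ne_x; case: x x1 x2 x3 => [[c a] s] /= x1 x2 x3.
by congr (_, _, _); apply: val_inj.
Qed.

Lemma W_state_series : W_series p = state_series p 0 0 0 - state_series p p.-1
  p.-1 0.
Proof.
rewrite W_series_rho // /state_series expr0 !mul1r mulr1.
have -> : rho_series p 0 = Fps (rho p).
  by apply/fpsP => n; rewrite -[LHS]/(rho_shift p 0 n) rho_shift0.
by rewrite -(ppow_shiftE p) exprMn; ring.
Qed.

Lemma E_output_correct k : E_output p k = W p k.
Proof.
rewrite -[W p k]/(cf (W_series p) k) W_state_series -[RHS]/(cf _ k - cf _ k).
have -> : cf (state_series p 0 0 0) k = rho p k.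
  by rewrite /state_series expr0 !mul1r mulr1 -rho_shift0.
have -> : cf (state_series p p.-1 p.-1 0) k =
    if (k < p.-1)%N then 0 else cf (state_series p 0 p.-1 0) (k - p.-1).
  by rewrite {1}/state_series cfXnM /state_series expr0 mul1r.
rewrite /E_output; case: ltnP => _; first by rewrite subr0.
by rewrite E_fold_init digits_valueK.
Qed.

Lemma dfao_runE (A : Type) (M : dfao p A) w :
  dfao_run M w = (dfao_out (foldl (@dfao_next _ _ M) (dfao_init M) w), size w).
Proof.
rewrite /dfao_run -[size w]add0n; move: (dfao_init M) 0%N => q t.
elim: w q t => [|d w IHw] q t /=; first by rewrite addn0.
by rewrite IHw addSnnS.
Qed.

(** Transposing the linear transitions: after reading the leading digits of a
    number, the automaton knows the coefficients of that index of all the state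
    series, and one more digit determines the next vector of coefficients. *)
Definition transposed_dfao : dfao p 'F_p :=
  @Dfao p 'F_p {ffun E_state p -> 'F_p}
    [ffun x => state_value 0 x]
    (fun g kappa => [ffun x : E_state p => \sum_(a' : 'I_p | (a' <= x.1.2)%N)
       let d := E_digit kappa x.1.1 a' in
       if (x.2 + d <= p)%N then
         'C(x.1.2, a')%:R / d`!%:R * g (next_state kappa x.1.1 a' x.2)
       else 0])
    (fun g => g (Ordinal p_gt0, Ordinal p_gt0, ord0) -
       g (Ordinal lt_p1, Ordinal lt_p1, ord0)).

Lemma W_automatic : automatic p (W p).
Proof.
exists transposed_dfao => n w <-; rewrite /dfao_eval dfao_runE /=.
have -> : foldl (@dfao_next _ _ transposed_dfao) (dfao_init transposed_dfao) w =
    [ffun x => state_value (word_value w) x].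
  rewrite /word_value; rewrite -[dfao_init _]/[ffun x => state_value 0%N x].
  elim: w 0%N => [|d w IHw] m //=; rewrite -IHw; congr foldl.
  apply/ffunP => x; rewrite !ffunE mulnC state_value_rec.
  by apply: eq_bigr => a' _; rewrite ffunE.
rewrite !ffunE -[W p _]/(cf (W_series p) _) W_state_series.
by rewrite -[RHS]/(cf _ _ - cf _ _).
Qed.

(** Capping the digit sum at [p + 1] is harmless as [rho] vanishes beyond [p]. *)
Lemma rho_dfao_correct n :
  dfao_run (rho_dfao p) (digits p n) = (rho p n, size (digits p n)).
Proof.
rewrite dfao_runE; congr (_, _).
pose st (q : nat) (x : 'F_p) : 'I_p.+2 * 'F_p := (inord (minn p.+1 q), x).
have fold_st w q x : foldl (@dfao_next _ _ (rho_dfao p)) (st q x) w =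
    st (q + \sum_(d <- w) d)%N (x * \prod_(d <- w) (d`!)%:R).
  elim: w q x => [|d w IHw] q x /=; first by rewrite !big_nil addn0 mulr1.
  rewrite !big_cons addnA mulrA -IHw; congr (foldl _ (_, _) _).
  apply: val_inj; rewrite /= !inordK ?ltnS ?geq_minl //; lia.
have -> : dfao_init (rho_dfao p) = st 0%N 1.
  by congr (_, _); apply: val_inj; rewrite /= inordK ?minn0.
rewrite fold_st add0n mul1r -/(digit_sum p n) -/(digit_fact p n) /rho /=.
rewrite inordK ?ltnS ?geq_minl // -(digit_sum_eq0 p_gt1 n).
set s := digit_sum p n; have [le_sp | lt_ps] := leqP s p.
  by have -> : minn p.+1 s = s by lia.
have -> : minn p.+1 s = p.+1 by lia.
have [-> ->] : (s == 0)%N = false /\ (s <= p.-1)%N = false by lia.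
have [-> ->] : (s == p)%N = false /\ (p.+1 == p)%N = false by lia.
by rewrite ifN //; lia.
Qed.

Lemma size_digits n : size (digits p n) = (trunc_log p n).+1.
Proof. by rewrite -(size_map val) val_digits // size_mkseq. Qed.

Lemma E_run_correct k : (E_run p k).1 = W p k.
Proof.
rewrite -E_output_correct /E_run rho_dfao_correct /E_output.
by case: ltnP => // _; rewrite dfao_runE.
Qed.

Lemma E_run_steps k : ((E_run p k).2 <= 2 * (trunc_log p k).+1)%N.
Proof.
rewrite /E_run rho_dfao_correct; case: ltnP => /= [_|le_k].
  by rewrite size_digits mul2n -addnn leq_addr.
rewrite dfao_runE /= !size_digits mul2n -addnn leq_add2l ltnS.
by apply: leq_trunc_log; rewrite leq_subr.
Qed.

Lemma trunc_log_bound (R : realType) k :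
  (trunc_log p k).+1%:R <=
    (1 + ln p%:R / ln 2%:R) * (ln (k + 2)%:R / ln p%:R) :> R.
Proof.
have ln_mono (a b : nat) : (0 < a <= b)%N -> ln a%:R <= ln b%:R :> R.
  case/andP=> a_gt0 le_ab; rewrite ler_ln ?posrE ?ltr0n ?ler_nat //.
  exact: leq_trans le_ab.
have lnp_gt0 : 0 < ln p%:R :> R by rewrite ln_gt0 // ltr1n.
have ln2_gt0 : 0 < ln 2%:R :> R by rewrite ln_gt0 // ltr1n.
rewrite mulrDl mul1r -natr1 lerD //.
  rewrite ler_pdivlMr // mulr_natl -lnXn ?ltr0n // -natrX; apply: ln_mono.
  rewrite expn_gt0 p_gt0; case: k => [|k]; first by rewrite trunc_log0 expn0.
  by rewrite (leq_trans (trunc_logP _ _)) // leq_addr.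
rewrite mulrACA [_^-1 / _]mulrC -mulrACA divff ?gt_eqF // mul1r.
by rewrite ler_pdivlMr // mul1r; apply: ln_mono; rewrite addn2.
Qed.

Lemma E_run_bound (R : realType) : exists C : R, forall k,
  (E_run p k).2%:R <= C * (ln (k + 2)%:R / ln p%:R).
Proof.
exists (2%:R * (1 + ln p%:R / ln 2%:R)) => k.
rewrite -mulrA; apply: le_trans (_ : (2 * (trunc_log p k).+1)%:R <= _).
  by rewrite ler_nat E_run_steps.
by rewrite natrM ler_pM2l ?ltr0n // trunc_log_bound.
Qed.
End Procedure.

(** * Degrees of simple extensions *)

Section FieldExtensions.
Variables (K L : fieldType) (iota : {rmorphism K -> L}).

Section Span.
Variables (I : finType) (e : I -> L).

Definition in_span (z : L) := exists c : I -> K, z = \sum_i iota (c i) * e i.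

Lemma in_span_gen i : in_span (e i).
Proof.
exists (fun j => (j == i)%:R); rewrite (bigD1 i) //= eqxx rmorph1 mul1r big1
  ?addr0 //.
by move=> j /negPf->; rewrite rmorph0 mul0r.
Qed.

Lemma in_spanD y z : in_span y -> in_span z -> in_span (y + z).
Proof.
move=> [c ->] [d ->]; exists (fun i => c i + d i); rewrite -big_split.
by apply: eq_bigr => i _; rewrite rmorphD mulrDl.
Qed.

Lemma in_spanZ a z : in_span z -> in_span (iota a * z).
Proof.
move=> [c ->]; exists (fun i => a * c i); rewrite mulr_sumr.
by apply: eq_bigr => i _; rewrite rmorphM mulrA.
Qed.

(** These elements form a ring containing the base field. *)
Definition preserves (z : L) := forall y, in_span y -> in_span (z * y).

Lemma preserves_gen z : (forall i, in_span (z * e i)) -> preserves z.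
Proof.
move=> pz y [c ->]; rewrite mulr_sumr; elim/big_ind: _ => [||i _].
- by exists (fun=> 0); rewrite big1 // => i _; rewrite rmorph0 mul0r.
- exact: in_spanD.
- by rewrite mulrCA; apply/in_spanZ/pz.
Qed.

Lemma preserves_base a : preserves (iota a).
Proof. by move=> y; apply: in_spanZ. Qed.

Lemma preserves1 : preserves 1.
Proof. by rewrite -(rmorph1 iota); apply: preserves_base. Qed.

Lemma preservesD y z : preserves y -> preserves z -> preserves (y + z).
Proof. by move=> py pz x sx; rewrite mulrDl; apply: in_spanD;
  [apply: py | apply: pz]. Qed.

Lemma preservesM y z : preserves y -> preserves z -> preserves (y * z).
Proof. by move=> py pz x sx; rewrite -mulrA; apply/py/pz. Qed.

Lemma preservesN y : preserves y -> preserves (- y).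
Proof. by move=> py; rewrite -mulN1r -(rmorphN1 iota);
  apply/preservesM/py/preserves_base. Qed.

Lemma preservesX y n : preserves y -> preserves (y ^+ n).
Proof.
move=> py; elim: n => [|n IHn]; first exact: preserves1.
by rewrite exprS; apply: preservesM.
Qed.

Lemma preserves_sum (J : finType) (P : pred J) (F : J -> L) :
  (forall j, P j -> preserves (F j)) -> preserves (\sum_(j | P j) F j).
Proof.
move=> pF; elim/big_ind: _ => //; last exact: preservesD.
by rewrite -(rmorph0 iota); apply: preserves_base.
Qed.

(** Cayley-Hamilton: the matrix of the multiplication by [w] on the generators
    has the vector of generators as an eigenvector. *)
Lemma preserves_annihilated (i0 : I) w : e i0 != 0 -> preserves w ->
  exists P : {poly K}, [/\ P != 0, size P = #|I|.+1 & root (map_poly iota P) w].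
Proof.
move=> nz_e pw; have ex i : exists c : I -> K, w * e i = \sum_j iota (c j) * e j.
  exact/pw/in_span_gen.
have [c def_c] := choice ex.
pose A : 'M[K]_#|I| := \matrix_(j, i) c (enum_val i) (enum_val j).
exists (char_poly A); rewrite size_char_poly monic_neq0 ?char_poly_monic //.
split=> //; rewrite map_char_poly -eigenvalue_root_char; apply/eigenvalueP.
exists (\row_j e (enum_val j)); last first.
  apply: contraNneq nz_e => /rowP/(_ (enum_rank i0)).
  by rewrite !mxE enum_rankK => ->.
apply/rowP=> i; rewrite !mxE def_c (reindex _ (onW_bij _ (enum_val_bij I))) /=.
by apply: eq_bigr => j _; rewrite !mxE mulrC.
Qed.
End Span.

(** A nonzero polynomial of least size vanishing at [w] is irreducible, so the
    polynomials in [w] form a field, in which the powers of [w] below its degree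
    are a basis. *)
Lemma adjoin_degree (w : L) (P : {poly K}) :
    P != 0 -> root (map_poly iota P) w ->
  exists2 d, (d < size P)%N & has_degree iota (adjoin iota w) d.
Proof.
move=> nzP rootP.
pose ann n := `[< exists Q : {poly K}, [/\ Q != 0, size Q = n & root (map_poly
  iota Q) w] >].
have ex_ann : exists n, ann n by exists (size P); apply/asboolP; exists P.
case: (ex_minnP ex_ann) => n /asboolP[m [nz_m size_m root_m]] min_n.
have min_m (Q : {poly K}) : root (map_poly iota Q) w -> (size Q < size m)%N ->
  Q = 0.
  move=> rootQ lt_Qm; apply/eqP; apply: contraTT lt_Qm => nzQ.
  by rewrite -leqNgt size_m min_n //; apply/asboolP; exists Q.
have m_gt0 : (0 < size m)%N by rewrite size_poly_gt0.
exists (size m).-1.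
  by rewrite prednK // size_m min_n //; apply/asboolP; exists P.
pose ev (Q : {poly K}) := (map_poly iota Q).[w].
have evD Q1 Q2 : ev (Q1 + Q2) = ev Q1 + ev Q2 by rewrite /ev rmorphD hornerD.
have evB Q1 Q2 : ev (Q1 - Q2) = ev Q1 - ev Q2 by rewrite /ev rmorphB hornerD
  hornerN.
have evM Q1 Q2 : ev (Q1 * Q2) = ev Q1 * ev Q2 by rewrite /ev rmorphM hornerM.
have ev1 : ev 1 = 1 by rewrite /ev rmorph1 hornerC.
have ev_m : ev m = 0 by apply/eqP.
have evE (Q : {poly K}) : (size Q <= (size m).-1)%N ->
    ev Q = \sum_(i < (size m).-1) iota Q`_i * w ^+ i.
  move=> le_Q; rewrite /ev (@horner_coef_wide _ (size m).-1) ?(leq_trans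
    (size_poly _ _)) //.
  by apply: eq_bigr => i _; rewrite coef_map.
have ev_inv Q : ev Q != 0 -> exists Q', ev Q' = (ev Q)^-1.
  move=> nzQ; have co_Qm : coprimep Q m.
    rewrite /coprimep; set g := gcdp Q m.
    have nz_g : g != 0 by rewrite gcdp_eq0 negb_and nz_m orbT.
    have /dvdpP[q def_Q] : g %| Q := dvdp_gcdl Q m.
    have /dvdpP[k def_m] : g %| m := dvdp_gcdr Q m.
    have nz_evg : ev g != 0.
      by apply: contraNneq nzQ => evg; rewrite def_Q evM evg mulr0.
    have k0 : root (map_poly iota k) w.
      by move/eqP: ev_m; rewrite def_m evM mulf_eq0 (negPf nz_evg) orbF.
    have nz_k : k != 0 by apply: contraNneq nz_m => k_0; rewrite def_m k_0 mul0r.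
    apply: contraNT (nz_k) => size_g; apply/eqP/min_m => //.
    rewrite def_m size_mul //.
    move: nz_g size_g; rewrite -size_poly_gt0 => g_gt0 size_g.
    have : (1 < size g)%N by rewrite ltn_neqAle eq_sym size_g.
    by move=> g_gt1; rewrite -subn1 -addnBA // -{1}[size k]addn0 ltn_add2l subn_gt0.
  have [[u1 u2] /= bez] := Bezout_eq1_coprimepP _ _ co_Qm.
  exists u1; apply: (mulIf nzQ); rewrite mulVf // -evM.
  by rewrite -ev1 -bez evD [ev (u2 * m)]evM ev_m mulr0 addr0.
have adjoinP z : adjoin iota w z -> exists Q, z = ev Q.
  move=> /(_ [pred z | `[< exists Q, z = ev Q >]]) adj.
  apply/asboolP; apply: adj.
  - split; rewrite ?inE.
    + by apply/asboolP; exists 1.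
    + move=> x y /asboolP[Q1 ->] /asboolP[Q2 ->]; apply/asboolP.
      by exists (Q1 - Q2); rewrite evB.
    move=> x y /asboolP[Q1 ->] /asboolP[Q2 ->]; apply/asboolP.
    have [->|/ev_inv[Q' <-]] := eqVneq (ev Q2) 0.
      by exists 0; rewrite invr0 mulr0 /ev rmorph0 horner0.
    by exists (Q1 * Q'); rewrite evM.
  - by move=> a; apply/asboolP; exists a%:P; rewrite /ev map_polyC hornerC.
  by apply/asboolP; exists 'X; rewrite /ev map_polyX hornerX.
exists (fun i => w ^+ i); split=> [i S [S1 SB SV] _ Sw | z /adjoinP[Q ->]].
  elim: (i : nat) => [|j IHj]; first exact: S1.
  have SVw := SV _ _ S1 Sw; rewrite div1r in SVw.
  by rewrite exprSr -[X in _ * X]invrK; apply: SV.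
have size_r : (size (Q %% m)%R <= (size m).-1)%N by rewrite -ltnS prednK //
  ltn_modp.
exists [ffun i : 'I_(size m).-1 => (Q %% m)`_i]; split.
  rewrite {1}(divp_eq Q m) evD evM ev_m mulr0 add0r evE //.
  by apply: eq_bigr => i _; rewrite ffunE.
move=> c; rewrite {1}(divp_eq Q m) evD evM ev_m mulr0 add0r => eq_c.
pose C := \poly_(i < (size m).-1) (if insub i is Some j then c j else 0).
have C_i (i : 'I_(size m).-1) : C`_i = c i by rewrite coef_poly ltn_ord valK.
have size_C : (size C <= (size m).-1)%N := size_poly _ _.
have : Q %% m - C = 0.
  apply: min_m; last first.
    rewrite -(prednK m_gt0) ltnS (leq_trans (size_polyD _ _)) // geq_max size_r.
    by rewrite size_polyN.
  apply/eqP; rewrite -/(ev _) evB eq_c (evE _ size_C); apply/eqP; rewrite subr_eq0.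
  by apply/eqP/eq_bigr => i _; rewrite C_i.
move/eqP; rewrite subr_eq0 => /eqP eqQ; apply/ffunP => i.
by rewrite ffunE eqQ C_i.
Qed.

End FieldExtensions.

(** * The degree of W *)

Section Degree.
Variable p : nat.
Hypotheses (p_pr : prime p) (p_odd : odd p).
Let p_gt0 : (0 < p)%N := prime_gt0 p_pr.
Let p_gt1 : (1 < p)%N := prime_gt1 p_pr.
Local Notation h := (ppow_series p 'F_p).
Local Notation iota := (@ratfun_laurent 'F_p).

(** An Artin-Schreier equation over [F_p (X, h)].  Over the local ring, [p J] is
    [H ^ p - H (X ^ p)]; subtracting the same relation at [X ^ p] leaves the mixed
    terms of [(X + H (X ^ p)) ^ p], all divisible by [p]. *)
Lemma ppow_quotient_exp (J : fps (zloc p)) :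
    ppow_series p _ ^+ p = fps_subXp p (ppow_series p _) + p%:R * J ->
  fps_map (zred p_pr) J ^+ p = fps_map (zred p_pr) J -
    \sum_(i < p | (0 < i)%N) ('C(p, i) %/ p)%:R * (fpsX ^+ (p - i) *
      (h - fpsX) ^+ i).
Proof.
set H := ppow_series p _ => def_J; set Y := fps_subXp p H.
have recH : H = fpsX + Y by exact: ppow_series_rec.
have recY : Y = fpsX ^+ p + fps_subXp p Y by rewrite /Y {1}recH fps_subXpD
  fps_subXpX.
have eqJ : J - fps_subXp p J =
    \sum_(i < p | (0 < i)%N) ('C(p, i) %/ p)%:R * (fpsX ^+ (p - i) * Y ^+ i).
  apply: (fps_natr_inj (@zloc_p_inj p p_pr)).
  have def_sJ : Y ^+ p = fps_subXp p Y + p%:R * fps_subXp p J.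
    have := congr1 (fps_subXp p) def_J; rewrite fps_subXpXn // fps_subXpD => ->.
    have sub_nat f n : fps_subXp p (n%:R * f) = n%:R *
      fps_subXp p f :> fps (zloc p).
      by apply/fpsP=> i; rewrite cf_natM !cf_subXp cf_natM; case: ifP;
        rewrite ?mulr0.
    by rewrite sub_nat.
  transitivity (H ^+ p - Y ^+ p - fpsX ^+ p).
    by rewrite def_J def_sJ -/Y {1}recY; ring.
  rewrite recH exprDn big_ord_recr /= subnn mul1r binn addrK.
  rewrite -(big_mkord xpredT (fun i => (fpsX ^+ (p - i) * Y ^+ i) *+ 'C(p, i))).
  rewrite mulr_sumr -(big_mkord (fun i => (0 < i)%N) (fun i => p%:R *
    (('C(p, i) %/ p)%:R * (fpsX ^+ (p - i) * Y ^+ i)))) [RHS]big_mkcond /=.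
  rewrite !(big_ltn p_gt0) subn0 bin0 mulr1 add0r [LHS]addrC addKr.
  rewrite !big_nat; apply: eq_bigr => i /andP[i_gt0 lt_ip].
  rewrite i_gt0 mulrA -natrM mulnC divnK ?mulr_natl //.
  by rewrite prime_dvd_bin // i_gt0.
have mapY : fps_map (zred p_pr) Y = h - fpsX.
  rewrite -(ppow_exp_Fp p_pr) fps_Frobenius //.
  by rewrite -(fps_map_ppow p (zred p_pr)) -fps_map_subXp.
have := congr1 (fps_map (zred p_pr)) eqJ;
  rewrite rmorphB rmorph_sum /= fps_map_subXp.
rewrite -fps_Frobenius // => eqJp.
rewrite -[LHS](subKr (fps_map (zred p_pr) J)) eqJp; congr (_ - _).
apply: eq_bigr => i _; rewrite rmorphM rmorph_nat rmorphM !rmorphXn /= fps_map_X.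
by rewrite mapY.
Qed.

(** The span of the [h ^ i J ^ j] with [i, j < p] is preserved by [h] and [J],
    hence by [W]. *)
Lemma W_degree : exists P : {poly {fraction {poly 'F_p}}},
  [/\ P != 0, size P = (p ^ 2).+1 & root (map_poly iota P) (tofrac (W_series p))].
Proof.
have [g size_g def_g] := rising_quotient p_pr; have [J def_J] := ppow_quotient p_pr.
have def_W := W_seriesE p_pr p_odd def_g def_J.
have qp := ppow_quotient_exp def_J; set q := fps_map _ J in def_W qp.
have hp := ppow_exp_Fp p_pr.
pose F := {fraction (fps 'F_p)}.
pose hF : F := tofrac h; pose qF : F := tofrac q; pose XF : F := tofrac fpsX.
pose e (ij : 'I_p * 'I_p) : F := hF ^+ ij.1 * qF ^+ ij.2.
pose i0 : 'I_p * 'I_p := (Ordinal p_gt0, Ordinal p_gt0).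
have e0 : e i0 = 1 by rewrite /e /= mulr1.
have iotaE a : iota (tofrac a) = tofrac (fps_of_poly a).
  by have := ratfun_laurent_frac a (oner_neq0 _); rewrite !rmorph1 !divr1.
have iotaX : XF = iota (tofrac 'X) by rewrite iotaE.
have span_e i j : (i < p)%N -> (j < p)%N -> in_span iota e (hF ^+ i * qF ^+ j).
  by move=> lt_ip lt_jp; apply: (in_span_gen iota e (Ordinal lt_ip, Ordinal lt_jp)).
have hFp : hF ^+ p = hF - XF by rewrite /hF -rmorphXn /= hp rmorphB.
have pX : preserves iota e XF by rewrite iotaX; apply: preserves_base.
have pconst (c : 'F_p) : preserves iota e (tofrac (fpsC c)).
  by rewrite -iotaE; apply: preserves_base.
have pnat n : preserves iota e n%:R by rewrite -(rmorph_nat iota);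
  apply: preserves_base.
have ph : preserves iota e hF.
  apply: preserves_gen => -[i j]; rewrite /e /= mulrA -exprS.
  have := ltn_ord i; rewrite leq_eqVlt => /predU1P[eq_ip | lt_ip];
    last exact: span_e.
  rewrite eq_ip hFp mulrDl mulNr -mulNr; apply: in_spanD; first exact: (span_e 1%N).
  rewrite iotaX -rmorphN; apply: in_spanZ; rewrite -[qF ^+ j]mul1r -(expr0 hF).
  exact: span_e.
have pq : preserves iota e qF.
  apply: preserves_gen => -[i j]; rewrite /e /= mulrCA -exprS.
  have := ltn_ord j; rewrite leq_eqVlt => /predU1P[-> | lt_jp]; last exact: span_e.
  have -> : qF ^+ p = qF - tofrac (\sum_(i < p | (0 < i)%N)
      ('C(p, i) %/ p)%:R * (fpsX ^+ (p - i) * (h - fpsX) ^+ i)).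
    by rewrite /qF -rmorphXn /= qp rmorphB.
  rewrite mulrBr; apply: in_spanD; first by rewrite -[qF]expr1; apply: span_e.
  rewrite -mulrN -[X in in_span _ _ X]mulr1 -e0.
  suff: preserves iota e (hF ^+ i * - tofrac (\sum_(i < p | (0 < i)%N)
      ('C(p, i) %/ p)%:R * (fpsX ^+ (p - i) * (h - fpsX) ^+ i))).
    by apply; apply: in_span_gen.
  apply: preservesM; first exact: preservesX.
  apply: preservesN; rewrite rmorph_sum; apply: preserves_sum => k _.
  rewrite rmorphM rmorph_nat rmorphM !rmorphXn rmorphB /=.
  apply: preservesM; first exact: pnat.
  apply: preservesM; apply: preservesX => //.
  by apply: preservesD => //; apply: preservesN.
have pW : preserves iota e (tofrac (W_series p)).
  rewrite def_W rmorphM rmorphB rmorph1 rmorphXn !rmorphD rmorphXn fps_evalE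
    rmorph_sum /=.
  apply: preservesM.
    by apply: preservesD; [apply: preserves1 | apply/preservesN/preservesX].
  apply: preservesD => //; apply: preservesD; last exact: preservesX.
  apply: preserves_sum => k _; rewrite rmorphM rmorphXn /=.
  by apply: preservesM; [apply: pconst | apply: preservesX].
have nz_e0 : e i0 != 0 by rewrite e0 oner_eq0.
have := preserves_annihilated nz_e0 pW.
by rewrite card_prod !card_ord mulnn.
Qed.

End Degree.

Theorem theorem1p3 (R : realType) (p : nat) (p_prime : prime p)
    (p_odd : odd p) :
  let iota := @ratfun_laurent 'F_p in
  let w := tofrac (W_series p) in
  [/\ algebraicOver iota w,
      exists2 d : nat, (d <= p ^ 2)%N & has_degree iota (adjoin iota w) d,
      automatic p (W p),
      forall k : nat, E_output p k = W p k
    & exists C : R, forall k : nat,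
        (E_run p k).1 = W p k /\
        (E_run p k).2%:R <= C * (ln (k + 2)%:R / ln p%:R)].
Proof.
move=> iota w; have [P [nzP size_P rootP]] := W_degree p_prime p_odd.
have [C bound_C] := E_run_bound p_prime p_odd R.
split; first by exists P.
- by have [d lt_d deg_d] := adjoin_degree nzP rootP; exists d;
  rewrite // -ltnS -size_P.
- exact: W_automatic.
- by move=> k; apply: E_output_correct.
by exists C => k; split; [apply: E_run_correct | apply: bound_C].
Qed.
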